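(* Let $0<p\ne q\le\infty$ (that is, $p,q\in(0,\infty]$ with $p\neq q$). Then $\ell_q(\ell_p)$ has no greedy basis (where $\ell_\infty$ is replaced with $c_0$ if some of the indices is $\infty$).
   Context: The scalar field is $\mathbb{R}$ or $\mathbb{C}$. A quasi-norm satisfies the axioms of a norm except that the triangle inequality is replaced by $\Vert f+g\Vert\le\kappa(\Vert f\Vert+\Vert g\Vert)$ for some $\kappa\ge1$; a quasi-Banach space is a vector space complete for the topology of a quasi-norm. For a quasi-Banach space $\mathbb{Y}$, $\ell_q(\mathbb{Y})$ is the space of sequences $(f_k)_{k=1}^\infty$ in $\mathbb{Y}$ with $(\Vert f_k\Vert)_{k=1}^\infty\in\ell_q$, with the quasi-norm given by the $\ell_q$ quasi-norm of $(\Vert f_k\Vert)_k$; similarly $c_0(\mathbb{Y})$ with $c_0$ in place of $\ell_q$. A basis of a quasi-Banach space $\mathbb{X}$ is a sequence $(\mathbf{x}_n)_{n=1}^\infty$ whose closed linear span is $\mathbb{X}$ and for which there is a (unique) sequence $(\mathbf{x}_n^* )_{n=1}^\infty$ in $\mathbb{X}^*$ with $\mathbf{x}_n^*(\mathbf{x}_k)=\delta_{k,n}$. It is $M$-bounded if $\sup_n\Vert\mathbf{x}_n\Vert\,\Vert\mathbf{x}_n^*\Vert<\infty$ and semi-normalized if $0<\inf_n\Vert\mathbf{x}_n\Vert\le\sup_n\Vert\mathbf{x}_n\Vert<\infty$. Put $\mathrm{supp}(f)=\{n:\mathbf{x}_n^*(f)\ne0\}$. A set $A\subseteq\mathbb{N}$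 is a greedy set of $f$ if $|\mathbf{x}_k^*(f)|\le|\mathbf{x}_n^*(f)|$ for all $n\in A$, $k\in\mathbb{N}\setminus A$. A greedy basis is an $M$-bounded semi-normalized basis for which there is $C\ge1$ with $\left\Vert f-\sum_{n\in A}\mathbf{x}_n^*(f)\mathbf{x}_n\right\Vert\le C\Vert f-z\Vert$ whenever $A$ is a finite greedy set of $f\in\mathbb{X}$ and $z\in\mathbb{X}$ satisfies $|\mathrm{supp}(z)|\le|A|$. *)

(* Defs.v *)
From HB Require Import structures.
From mathcomp Require Import all_boot all_order all_algebra finmap complex.
From mathcomp Require Import all_classical all_reals ereal topology normedtype.
From mathcomp Require Import sequences exp ring.

Set Implicit Arguments.
Unset Strict Implicit.
Unset Printing Implicit Defensive.

Import Order.TTheory GRing.Theory Num.Theory.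
Import numFieldNormedType.Exports.

Local Open Scope classical_set_scope.
Local Open Scope ring_scope.

Variant scalar_kind := RealScalars | ComplexScalars.

Definition scalar (R : realType) (s : scalar_kind) : numFieldType :=
  match s with RealScalars => R | ComplexScalars => R[i]%C end.

(* The norm of R[i] as a numFieldType is R[i]-valued; this one is real. *)
Definition modulus (R : realType) (s : scalar_kind) : scalar R s -> R :=
  match s with
  | RealScalars => fun a : R => `|a|
  | ComplexScalars => fun a : R[i]%C => ComplexField.Normc.normc a
  end.

Section modulus_theory.
Context {R : realType} {s : scalar_kind}.
Implicit Types a b : scalar R s.

Lemma modulus_ge0 a : 0 <= modulus a.
Proof.
case: s a => [a|[a b]] /=; first exact: normr_ge0.
exact: sqrtr_ge0.
Qed.

Lemma modulus0 : modulus (0 : scalar R s) = 0.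
Proof.
by case: s => /=; [exact: normr0 | exact: ComplexField.Normc.normc0].
Qed.

Lemma modulus1 : modulus (1 : scalar R s) = 1.
Proof.
by case: s => /=; [exact: normr1 | exact: ComplexField.Normc.normc1].
Qed.

Lemma modulusN1 : modulus (-1 : scalar R s) = 1.
Proof.
case: s => /=; first by rewrite normrN1.
exact: etrans (@normcN R 1) (ComplexField.Normc.normc1 R).
Qed.

Lemma modulus_eq0 a : modulus a = 0 -> a = 0.
Proof.
case: s a => a /=; first by move/eqP; rewrite normr_eq0 => /eqP.
exact: ComplexField.Normc.eq0_normc.
Qed.

Lemma modulusM a b : modulus (a * b) = modulus a * modulus b.
Proof.
case: s a b => a b /=; first exact: normrM.
exact: ComplexField.Normc.normcM.
Qed.

Lemma modulusD a b : modulus (a + b) <= modulus a + modulus b.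
Proof.
case: s a b => a b /=; first exact: ler_normD.
exact: (@le_normcD R a b).
Qed.

Lemma cauchy_real (u : nat -> R) :
  (forall e, 0 < e -> exists N, forall m n, (N <= m)%N -> (N <= n)%N ->
     `|u m - u n| <= e) ->
  exists l, forall e, 0 < e -> exists N, forall n, (N <= n)%N ->
     `|u n - l| <= e.
Proof.
move=> cu.
have : cvgn u.
  apply/cauchy_cvgP/cauchy_ballP => e e0.
  have [N HN] := cu (e / 2) (divr_gt0 e0 (ltr0n _ 2)).
  pose A := u @` [set n | (N <= n)%N].
  exists (A, A); first by split; exists N => // n Nn; exists n.
  move=> [_ _] [[m /= Hm <-] [n /= Hn <-]]; rewrite /ball /=.
  apply: le_lt_trans (HN _ _ Hm Hn) _.
  by rewrite ltr_pdivrMr// ltr_pMr// ltr1n.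
move=> /cvg_ex[l /cvgrPdist_le ul]; exists l => e e0.
have [N _ HN] := ul e e0; exists N => n Nn.
by rewrite distrC; exact: HN.
Qed.

Lemma cauchy_scalar (u : nat -> scalar R s) :
  (forall e, 0 < e -> exists N, forall m n, (N <= m)%N -> (N <= n)%N ->
     modulus (u m - u n) <= e) ->
  exists l, forall e, 0 < e -> exists N, forall n, (N <= n)%N ->
     modulus (u n - l) <= e.
Proof.
case: s u => u cu; first exact: cauchy_real cu.
have normRe (z : R[i]%C) : `|complex.Re z| <= ComplexField.Normc.normc z.
  case: z => x y /=; rewrite -sqrtr_sqr ler_sqrt ?addr_ge0 ?sqr_ge0//.
  by rewrite lerDl sqr_ge0.
have normIm (z : R[i]%C) : `|complex.Im z| <= ComplexField.Normc.normc z.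
  case: z => x y /=; rewrite -sqrtr_sqr ler_sqrt ?addr_ge0 ?sqr_ge0//.
  by rewrite lerDr sqr_ge0.
have [a Ha] : exists l, forall e, 0 < e -> exists N, forall n, (N <= n)%N ->
     `|complex.Re (u n) - l| <= e.
  apply: cauchy_real => e e0; have [N HN] := cu e e0; exists N => m n Nm Nn.
  apply: le_trans (HN m n Nm Nn); apply: le_trans (normRe _).
  by case: (u m) => ? ?; case: (u n) => ? ?.
have [b Hb] : exists l, forall e, 0 < e -> exists N, forall n, (N <= n)%N ->
     `|complex.Im (u n) - l| <= e.
  apply: cauchy_real => e e0; have [N HN] := cu e e0; exists N => m n Nm Nn.
  apply: le_trans (HN m n Nm Nn); apply: le_trans (normIm _).
  by case: (u m) => ? ?; case: (u n) => ? ?.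
exists (a +i* b)%C => e e0.
have e20 : 0 < e / 2 by rewrite divr_gt0.
have [M HM] := Ha _ e20; have [N HN] := Hb _ e20.
exists (maxn M N) => n; rewrite geq_max => /andP[/HM + /HN].
have normRI (z : R[i]%C) : ComplexField.Normc.normc z <=
    `|complex.Re z| + `|complex.Im z|.
  case: z => x y /=; rewrite -(@ler_pXn2r _ 2) ?nnegrE ?sqrtr_ge0 ?addr_ge0//.
  rewrite sqr_sqrtr ?addr_ge0 ?sqr_ge0// sqrrD !real_normK ?num_real//.
  by rewrite addrAC lerDl mulrn_wge0 ?mulr_ge0.
move=> Hx Hy; apply: le_trans (normRI _) _; rewrite [leRHS](splitr e).
by case: (u n) Hx Hy => x y /= Hx Hy; exact: lerD.
Qed.

End modulus_theory.

Record quasiBanach (R : realType) (s : scalar_kind) := QuasiBanach {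
  qb_carrier :> lmodType (scalar R s);
  qnorm : qb_carrier -> R;
  qnorm_ge0 : forall f, 0 <= qnorm f;
  qnorm_eq0 : forall f, qnorm f = 0 -> f = 0;
  qnormZ : forall a f, qnorm (a *: f) = modulus a * qnorm f;
  qnormD : exists2 kappa : R, 1 <= kappa &
    forall f g, qnorm (f + g) <= kappa * (qnorm f + qnorm g);
  qnorm_complete : forall u : nat -> qb_carrier,
    (forall e, 0 < e -> exists N, forall m n, (N <= m)%N -> (N <= n)%N ->
       qnorm (u m - u n) <= e) ->
    exists l, forall e, 0 < e -> exists N, forall n, (N <= n)%N ->
       qnorm (u n - l) <= e
}.
Arguments qnorm {R s q} f : rename.

Section quasiBanach_theory.
Context {R : realType} {s : scalar_kind} {X : quasiBanach R s}.
Implicit Types f g : X.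

Lemma qnorm0 : qnorm (0 : X) = 0.
Proof. by rewrite -(scale0r (0 : X)) qnormZ modulus0 mul0r. Qed.

Lemma qnormN f : qnorm (- f) = qnorm f.
Proof. by rewrite -scaleN1r qnormZ modulusN1 mul1r. Qed.

Lemma qnormB f g : qnorm (f - g) = qnorm (g - f).
Proof. by rewrite -qnormN opprB. Qed.

End quasiBanach_theory.

Section scalar_space.
Variables (R : realType) (s : scalar_kind).

Lemma modulusD_ex : exists2 kappa : R, 1 <= kappa &
  forall a b : scalar R s, modulus (a + b) <= kappa * (modulus a + modulus b).
Proof. by exists 1 => // a b; rewrite mul1r modulusD. Qed.

Definition scalar_space : quasiBanach R s :=
  @QuasiBanach R s (scalar R s)^o (@modulus R s) modulus_ge0 modulus_eq0
    modulusM modulusD_ex cauchy_scalar.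

End scalar_space.

(* Membership and quasi-norm of a nonnegative real sequence in l_q, and in c_0
   when q = +oo; only used for 0 < q. *)
Definition in_lq (R : realType) (q : \bar R) (u : nat -> R) : Prop :=
  match q with
  | r%:E => cvgn (series (fun k => u k `^ r))
  | +oo%E => u @ \oo --> (0 : R)
  | -oo%E => False
  end.

Definition lq_norm (R : realType) (q : \bar R) (u : nat -> R) : R :=
  match q with
  | r%:E => limn (series (fun k => u k `^ r)) `^ r^-1
  | +oo%E => sup (range u)
  | -oo%E => 0
  end.

Section lq_theory.
Context {R : realType}.
Implicit Types (r c : R) (q : \bar R) (u v w : nat -> R).

Lemma powRD_le r (a b : R) : 0 < r -> 0 <= a -> 0 <= b ->
  (a + b) `^ r <= 2 `^ r * (a `^ r + b `^ r).
Proof.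
move=> r0; wlog ab : a b / a <= b => [H a0 b0|a0 b0].
  have [/H->//|/ltW ba] := leP a b.
  by rewrite addrC [X in _ * X]addrC H.
apply: (@le_trans _ _ ((2 * b) `^ r)).
  rewrite ge0_ler_powR ?nnegrE ?addr_ge0 ?mulr_ge0 ?(ltW r0)//.
  by rewrite mulr_natl mulr2n lerD2r.
by rewrite powRM// ler_wpM2l ?powR_ge0// lerDr powR_ge0.
Qed.

Lemma powRK r (a : R) : 0 < r -> 0 <= a -> (a `^ r) `^ r^-1 = a.
Proof. by move=> r0 a0; rewrite -powRrM divff ?gt_eqF// powRr1. Qed.

Lemma powRVK r (a : R) : 0 < r -> 0 <= a -> (a `^ r^-1) `^ r = a.
Proof. by move=> r0 a0; rewrite -powRrM mulVf ?gt_eqF// powRr1. Qed.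

Lemma ler_powR_inv r (a b : R) : 0 < r -> 0 <= a -> 0 <= b ->
  a `^ r <= b `^ r -> a <= b.
Proof.
move=> r0 a0 b0 ab; rewrite -(powRK r0 a0) -(powRK r0 b0).
by apply: ge0_ler_powR; rewrite ?nnegrE ?powR_ge0 ?invr_ge0 ?(ltW r0).
Qed.

Lemma series_powR_nd r u : nondecreasing_seq (series (fun k => u k `^ r)).
Proof. by apply/nondecreasing_series => n _ _; exact: powR_ge0. Qed.

Lemma lq_of_bound r u (B : R) : 0 < r -> 0 <= B ->
  (forall n, series (fun k => u k `^ r) n <= B `^ r) ->
  in_lq r%:E u /\ lq_norm r%:E u <= B.
Proof.
move=> r0 B0 uB; have cu : in_lq r%:E u.
  apply: nondecreasing_is_cvgn; first exact: series_powR_nd.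
  by exists (B `^ r) => _ [n _ <-].
split=> //=; rewrite -[leRHS](powRK r0 B0).
have lB : limn (series (fun k => u k `^ r)) <= B `^ r.
  by apply: limr_le => //; apply: nearW.
apply: ge0_ler_powR; rewrite ?nnegrE ?powR_ge0 ?invr_ge0 ?(ltW r0)//.
apply: limr_ge => //; apply: nearW => n.
by apply: sumr_ge0 => k _; exact: powR_ge0.
Qed.

Lemma series_le_lq_norm r u n : 0 < r -> in_lq r%:E u ->
  series (fun k => u k `^ r) n <= lq_norm r%:E u `^ r.
Proof.
move=> r0 cu /=; rewrite powRVK//.
  by apply: nondecreasing_cvgn_le => //; exact: series_powR_nd.
apply: limr_ge => //; apply: nearW => m.
by apply: sumr_ge0 => k _; exact: powR_ge0.
Qed.

Lemma c0_le_sup u k : in_lq +oo%E u -> u k <= lq_norm +oo%E u.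
Proof.
move=> u0; apply: ub_le_sup; last by exists k.
have /cvg_seq_bounded[M [_ uM]] : cvgn (u : R^nat).
  by apply/cvg_ex; exists (0 : R).
exists (M + 1) => _ [n _ <-]; apply: le_trans (ler_norm _) _.
by apply: uM => //; rewrite ltrDl.
Qed.

Lemma le_lq_norm q u k : (0 < q)%E -> (forall n, 0 <= u n) -> in_lq q u ->
  u k <= lq_norm q u.
Proof.
case: q => [r| |//] q0 u0 cu; last exact: c0_le_sup.
rewrite lte_fin in q0.
have := series_le_lq_norm k.+1 q0 cu.
rewrite /series /= big_nat_recr//= => H.
apply: (ler_powR_inv q0 (u0 k)); first exact: powR_ge0.
apply: le_trans H; rewrite lerDr.
by apply: sumr_ge0 => j _; exact: powR_ge0.
Qed.

Lemma lq_norm_ge0 q u : (0 < q)%E -> (forall n, 0 <= u n) -> in_lq q u ->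
  0 <= lq_norm q u.
Proof. by move=> q0 u0 cu; apply: le_trans (u0 0%N) (le_lq_norm _ _ _ _). Qed.

Lemma lq_scale_le q u c : (0 < q)%E -> (forall n, 0 <= u n) -> 0 <= c ->
  in_lq q u ->
  in_lq q (fun n => c * u n) /\
  lq_norm q (fun n => c * u n) <= c * lq_norm q u.
Proof.
case: q => [r| |//] q0 u0 c0 cu; have nu0 := lq_norm_ge0 q0 u0 cu.
  rewrite lte_fin in q0; apply: lq_of_bound => //; first exact: mulr_ge0.
  move=> n; rewrite powRM//.
  apply: le_trans (ler_wpM2l (powR_ge0 _ _) (series_le_lq_norm n q0 cu)).
  rewrite /series /= mulr_sumr; apply: ler_sum => k _.
  by rewrite powRM.
split.
  by rewrite /= -[X in _ --> X](mulr0 c); apply: cvgMr.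
apply: ge_sup; first by exists (c * u 0%N), 0%N.
move=> _ [n _ <-]; apply: ler_wpM2l => //; exact: c0_le_sup.
Qed.

Lemma lq_scale q u c : (0 < q)%E -> (forall n, 0 <= u n) -> 0 <= c ->
  in_lq q u -> lq_norm q (fun n => c * u n) = c * lq_norm q u.
Proof.
move=> q0 u0 c0 cu; have [cu' le1] := lq_scale_le q0 u0 c0 cu.
apply/eqP; rewrite eq_le le1 /=.
have [->|cn0] := eqVneq c 0.
  by rewrite mul0r lq_norm_ge0// => [n|]; rewrite ?mul0r//;
     have [] := lq_scale_le q0 u0 (lexx 0) cu.
have cp : 0 < c by rewrite lt_def cn0.
have ci : 0 <= c^-1 by rewrite invr_ge0.
have [_] := lq_scale_le q0 (fun n => mulr_ge0 c0 (u0 n)) ci cu'.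
under eq_fun do rewrite mulKf//.
by rewrite -ler_pdivlMl.
Qed.

Definition lq_const q c : R :=
  match q with r%:E => 2 * c * 2 `^ r^-1 | _ => c end.

Lemma lq_const_ge1 q c : (0 < q)%E -> 1 <= c -> 1 <= lq_const q c.
Proof.
case: q => [r| |] //= q0 c1; rewrite lte_fin in q0.
have h : 1 <= 2 `^ r^-1 :> R.
  have e1 : 1 `^ r^-1 = 1 :> R by rewrite powR1.
  rewrite -[leLHS]e1; apply: ge0_ler_powR;
  by rewrite ?nnegrE ?invr_ge0 ?(ltW q0)// ler1n.
by rewrite mulr_ege1// mulr_ege1// ler1n.
Qed.

Lemma lq_dom q u v w c : (0 < q)%E -> 0 <= c ->
  (forall n, 0 <= u n) -> (forall n, 0 <= v n) -> (forall n, 0 <= w n) ->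
  (forall n, w n <= c * (u n + v n)) -> in_lq q u -> in_lq q v ->
  in_lq q w /\ lq_norm q w <= lq_const q c * (lq_norm q u + lq_norm q v).
Proof.
move=> q0 c0 u0 v0 w0 wuv cu cv.
have nu0 := lq_norm_ge0 q0 u0 cu; have nv0 := lq_norm_ge0 q0 v0 cv.
case: q q0 cu cv nu0 nv0 => [r| |//] q0 cu cv nu0 nv0; last first.
  split.
    apply: (@squeeze_cvgr _ _ _ _ (fun=> 0) (fun n => c * (u n + v n))).
    - by apply: nearW => n; rewrite w0 wuv.
    - exact: cvg_cst.
    - rewrite -[X in _ --> X](mulr0 c); apply: cvgMr.
      by rewrite -[X in _ --> X](addr0 0); exact: cvgD.
  apply: ge_sup; first by exists (w 0%N), 0%N.
  move=> _ [n _ <-]; apply: le_trans (wuv n) _; apply: ler_wpM2l => //.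
  by apply: lerD; exact: c0_le_sup.
rewrite lte_fin in q0.
have HA n := series_le_lq_norm n q0 cu; have HB n := series_le_lq_norm n q0 cv.
move: (lq_norm r%:E u) (lq_norm r%:E v) nu0 nv0 HA HB => A B nu0 nv0 HA HB.
have AB0 := addr_ge0 nu0 nv0; have z2 : 0 <= 2 :> R by [].
have K0 : 0 <= 2 * c * 2 `^ r^-1 by apply/mulr_ge0/powR_ge0/mulr_ge0.
apply: lq_of_bound => //; first exact: mulr_ge0.
move=> n; rewrite /lq_const (powRM _ K0 AB0) (powRM _ (mulr_ge0 z2 c0)).
  2: exact: powR_ge0.
rewrite (powRM _ z2 c0) powRVK//.
apply: (@le_trans _ _ (2 `^ r * c `^ r * (A `^ r + B `^ r))).
  apply: (@le_trans _ _ (2 `^ r * c `^ r *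
     (series (fun k => u k `^ r) n + series (fun k => v k `^ r) n))).
    rewrite /series /= -big_split/= mulr_sumr; apply: ler_sum => k _.
    apply: (@le_trans _ _ ((c * (u k + v k)) `^ r)).
      by apply: ge0_ler_powR; rewrite ?nnegrE ?mulr_ge0 ?addr_ge0 ?(ltW q0).
    rewrite powRM ?addr_ge0// [2 `^ r * _]mulrC -mulrA; apply: ler_wpM2l.
      exact: powR_ge0.
    exact: powRD_le.
  apply: ler_wpM2l; first by rewrite mulr_ge0 ?powR_ge0.
  exact: lerD.
rewrite -[leRHS]mulrA; apply: ler_wpM2l; first by rewrite mulr_ge0 ?powR_ge0.
rewrite mulr_natl mulr2n; apply: lerD;
  by apply: ge0_ler_powR; rewrite ?nnegrE ?addr_ge0 ?(ltW q0)// ?lerDl ?lerDr.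
Qed.

Lemma in_lq0 q : (0 < q)%E -> in_lq q (fun=> 0 : R).
Proof.
case: q => [r| |//] q0; last exact: cvg_cst.
rewrite lte_fin in q0.
have [n|//] := @lq_of_bound r (fun=> 0) 0 q0 (lexx 0).
by rewrite /series /= big1 ?powR_ge0// => k _; rewrite powR0// gt_eqF.
Qed.

Lemma lq_fatou q w c (B : R) : (0 < q)%E -> 1 <= c -> 0 < B ->
  (forall n, 0 <= w n) ->
  (forall K (d : R), 0 < d -> exists u, [/\ forall k, 0 <= u k, in_lq q u,
     lq_norm q u <= B & forall k, (k < K)%N -> w k <= c * (u k + d)]) ->
  (q = +oo%E -> in_lq q w) ->
  in_lq q w /\ lq_norm q w <= lq_const q c * (B + B).
Proof.
move=> q0 c1 B0 w0 H woo; have c0 : 0 <= c by exact: le_trans c1.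
case: q q0 H woo => [r| |//] q0 H woo; last first.
  split; first exact: woo.
  apply: ge_sup; first by exists (w 0%N), 0%N.
  move=> _ [n _ <-]; have [u [u0 cu uB wu]] := H n.+1 B B0.
  apply: le_trans (wu n (ltnSn n)) _; apply: ler_wpM2l => //.
  by rewrite lerD2r; apply: le_trans (c0_le_sup n cu) uB.
rewrite lte_fin in q0; have B0' := ltW B0.
have AB0 := addr_ge0 B0' B0'; have z2 : 0 <= 2 :> R by [].
have K0 : 0 <= 2 * c * 2 `^ r^-1 by apply/mulr_ge0/powR_ge0/mulr_ge0.
apply: lq_of_bound => //; first exact: mulr_ge0.
move=> n; rewrite /lq_const (powRM _ K0 AB0) (powRM _ (mulr_ge0 z2 c0)).
  2: exact: powR_ge0.
rewrite (powRM _ z2 c0) powRVK//.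
pose d := B * n.+1%:R `^ (- r^-1).
have d0 : 0 < d by rewrite mulr_gt0// powR_gt0.
have [u [u0 cu uB wu]] := H n d d0.
have dr : n%:R * d `^ r <= B `^ r.
  rewrite powRM ?powR_ge0// -powRrM mulNr mulVf ?gt_eqF// powR_inv1//.
  rewrite mulrCA ler_piMr ?powR_ge0// ler_pdivrMr// mul1r ler_nat.
  exact: leqnSn.
apply: (@le_trans _ _ (2 `^ r * c `^ r * (B `^ r + B `^ r))); last first.
  rewrite -[leRHS]mulrA; apply: ler_wpM2l; first by rewrite mulr_ge0 ?powR_ge0.
  rewrite mulr_natl mulr2n; apply: lerD;
  by apply: ge0_ler_powR; rewrite ?nnegrE ?addr_ge0 ?(ltW q0)// ?lerDl ?lerDr.
apply: (@le_trans _ _ (2 `^ r * c `^ r *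
   (series (fun k => u k `^ r) n + n%:R * d `^ r))); last first.
  apply: ler_wpM2l; first by rewrite mulr_ge0 ?powR_ge0.
  apply: lerD => //; apply: le_trans (series_le_lq_norm n q0 cu) _.
  by apply: ge0_ler_powR; rewrite ?nnegrE ?(ltW q0)// lq_norm_ge0.
have -> : n%:R * d `^ r = \sum_(0 <= k < n) d `^ r.
  by rewrite sumr_const_nat subn0 mulr_natl.
rewrite /series /= -big_split/= mulr_sumr big_nat [leRHS]big_nat.
apply: ler_sum => k /andP[_ kn].
apply: (@le_trans _ _ ((c * (u k + d)) `^ r)).
  apply: ge0_ler_powR; rewrite ?nnegrE ?mulr_ge0 ?addr_ge0 ?(ltW q0) ?(ltW d0)//.
  exact: wu.
rewrite powRM ?addr_ge0 ?(ltW d0)// [2 `^ r * _]mulrC -mulrA; apply: ler_wpM2l.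
  exact: powR_ge0.
by apply: powRD_le => //; exact: ltW.
Qed.

End lq_theory.

Section ell.
Context {R : realType} {s : scalar_kind}.
Variables (q : \bar R) (q0 : (0 < q)%E) (Y : quasiBanach R s).

Definition ell_pred of (0 < q)%E : {pred nat -> Y} :=
  fun f => `[< in_lq q (fun k => qnorm (f k)) >].

Lemma ell_predP f : reflect (in_lq q (fun k => qnorm (f k))) (f \in ell_pred q0).
Proof. exact: asboolP. Qed.

Lemma ell_submod_closed : submod_closed (ell_pred q0).
Proof.
have [kappa k1 kD] := qnormD Y; have k0 : 0 <= kappa by exact: le_trans k1.
have n0 (f : nat -> Y) k : 0 <= qnorm (f k) by exact: qnorm_ge0.
split.
  apply/ell_predP; rewrite (_ : (fun k => _) = fun=> 0); first exact: in_lq0.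
  by apply/funext => k; exact: qnorm0.
move=> a f g /ell_predP Hf /ell_predP Hg; apply/ell_predP.
have [Haf _] := lq_scale_le q0 (n0 f) (modulus_ge0 a) Hf.
apply: (lq_dom q0 k0 _ (n0 g) _ _ Haf Hg).1 => [k|k|k].
- by rewrite mulr_ge0 ?modulus_ge0 ?qnorm_ge0.
- exact: qnorm_ge0.
- by rewrite -qnormZ; exact: kD.
Qed.

HB.instance Definition _ :=
  GRing.isSubmodClosed.Build _ _ (ell_pred q0) ell_submod_closed.

Record ell_type := EllType {
  ell_val :> nat -> Y;
  ell_valP : ell_val \in ell_pred q0
}.

HB.instance Definition _ := [isSub for ell_val].
HB.instance Definition _ := [Choice of ell_type by <:].
HB.instance Definition _ := [SubChoice_isSubLmodule of ell_type by <:].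

Definition ell_norm (f : ell_type) : R := lq_norm q (fun k => qnorm (f k)).

Lemma ell_in (f : ell_type) : in_lq q (fun k => qnorm (f k)).
Proof. exact/ell_predP/ell_valP. Qed.

Let n0 (f : nat -> Y) k : 0 <= qnorm (f k).
Proof. exact: qnorm_ge0. Qed.

Lemma qnorm_le_ell (f : ell_type) k : qnorm (f k) <= ell_norm f.
Proof. exact: (le_lq_norm k q0 (n0 f) (ell_in f)). Qed.

Lemma ell_norm_ge0 (f : ell_type) : 0 <= ell_norm f.
Proof. exact: (lq_norm_ge0 q0 (n0 f) (ell_in f)). Qed.

Lemma ell_norm_eq0 (f : ell_type) : ell_norm f = 0 -> f = 0.
Proof.
move=> f0; apply/val_inj/funext => k; apply: qnorm_eq0; apply/eqP.
by rewrite eq_le qnorm_ge0 andbT -f0 qnorm_le_ell.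
Qed.

Lemma ell_normZ a (f : ell_type) : ell_norm (a *: f) = modulus a * ell_norm f.
Proof.
rewrite -(lq_scale q0 (n0 f) (modulus_ge0 a) (ell_in f)).
by congr lq_norm; apply/funext => k; rewrite -qnormZ.
Qed.

Lemma ell_normD : exists2 kappa : R, 1 <= kappa &
  forall f g : ell_type, ell_norm (f + g) <= kappa * (ell_norm f + ell_norm g).
Proof.
have [kappa k1 kD] := qnormD Y; have k0 : 0 <= kappa by exact: le_trans k1.
exists (lq_const q kappa); first exact: lq_const_ge1.
move=> f g.
exact: (lq_dom q0 k0 (n0 f) (n0 g) (n0 (f + g)) (fun k => kD (f k) (g k))
  (ell_in f) (ell_in g)).2.
Qed.

Lemma ell_complete (u : nat -> ell_type) :
  (forall e, 0 < e -> exists N, forall m n, (N <= m)%N -> (N <= n)%N ->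
     ell_norm (u m - u n) <= e) ->
  exists l, forall e, 0 < e -> exists N, forall n, (N <= n)%N ->
     ell_norm (u n - l) <= e.
Proof.
have [kappa k1 kD] := qnormD Y; have k0 : 0 <= kappa by exact: le_trans k1.
move=> cu.
have /choice[l Hl] k : exists l, forall e, 0 < e -> exists N, forall n,
    (N <= n)%N -> qnorm (u n k - l) <= e.
  apply: qnorm_complete => e e0; have [N HN] := cu e e0; exists N => m n Nm Nn.
  by apply: le_trans (HN m n Nm Nn); exact: (qnorm_le_ell (u m - u n)).
have unif K d N : 0 < d -> exists2 n, (N <= n)%N &
    forall k, (k < K)%N -> qnorm (u n k - l k) <= d.
  move=> d0; have /choice[M HM] k := Hl k d d0.
  exists (maxn N (\max_(k < K) M k)); first exact: leq_maxl.
  move=> k kK; apply: HM; apply: leq_trans (leq_maxr _ _).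
  exact: (leq_bigmax (Ordinal kK)).
have loo : q = +oo%E -> in_lq q (fun k => qnorm (l k)).
  move=> qoo; rewrite qoo /=; apply/cvgrPdist_le => e e0.
  pose d := e / (2 * kappa * kappa * 2).
  have kp : 0 < kappa by exact: lt_le_trans k1.
  have d0 : 0 < d by rewrite divr_gt0// !mulr_gt0.
  have [N HN] := cu d d0.
  have := ell_in (u N); rewrite {1}qoo /= => /cvgrPdist_le /(_ d d0).
  apply: filterS => k; rewrite !sub0r !normrN !ger0_norm ?qnorm_ge0// => ukd.
  have [n Nn Hn] := unif k.+1 d N d0.
  have -> : l k = u N k + ((u n k - u N k) + (l k - u n k)).
    by rewrite [(_ - _) + _ in RHS]addrC subrKA addrC subrK.
  apply: le_trans (kD _ _) _.
  apply: (@le_trans _ _ (kappa * (d + kappa * (d + d)))).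
    apply: ler_wpM2l => //; apply: lerD => //.
    apply: le_trans (kD _ _) _; apply: ler_wpM2l => //; apply: lerD.
      by apply: le_trans (HN n N Nn (leqnn N)); exact: (qnorm_le_ell (u n - u N)).
    by rewrite qnormB; exact: Hn.
  apply: (@le_trans _ _ (kappa * (kappa * (d + d) + kappa * (d + d)))).
    apply: ler_wpM2l => //; rewrite lerD2r -[leLHS]mul1r.
    by apply: ler_pM; rewrite ?(ltW d0)// lerDl ltW.
  rewrite le_eqVlt; apply/orP; left; apply/eqP; rewrite /d; field.
  by rewrite gt_eqF.
have tail e : 0 < e -> exists N, forall n, (N <= n)%N ->
    in_lq q (fun k => qnorm (u n k - l k)) /\
    lq_norm q (fun k => qnorm (u n k - l k)) <= lq_const q kappa * (e + e).
  move=> e0; have [N HN] := cu e e0; exists N => m Nm.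
  apply: lq_fatou => //.
  - by move=> k; exact: qnorm_ge0.
  - move=> K d d0; have [n Nn Hn] := unif K d N d0.
    exists (fun k => qnorm ((u m - u n) k)); split.
    + exact: n0.
    + exact: ell_in.
    + exact: HN.
    + move=> k kK; have -> : u m k - l k = (u m k - u n k) + (u n k - l k).
        by rewrite addrA subrK.
      apply: le_trans (kD _ _) _; apply: ler_wpM2l => //; apply: lerD => //.
      exact: Hn.
  - move=> qoo; have /loo Hl' := qoo.
    apply: (lq_dom q0 k0 (n0 (u m)) (n0 l) _ _ (ell_in (u m)) Hl').1 => k.
      exact: qnorm_ge0.
    by rewrite -[qnorm (l k)]qnormN; exact: kD.
have lP : l \in ell_pred q0.
  have [N HN] := tail 1 ltr01; have [HlN _] := HN N (leqnn N).
  rewrite -(subrK (ell_val (u N)) l) -opprB; apply: rpredD (ell_valP _).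
  by rewrite rpredN; apply/ell_predP.
exists (EllType lP) => e e0.
have c1 := lt_le_trans ltr01 (lq_const_ge1 q0 k1).
have e0' : 0 < e / lq_const q kappa / 2 by rewrite !divr_gt0.
have [N HN] := tail _ e0'; exists N => n Nn.
have [_ H] := HN n Nn; apply: le_trans H _.
by rewrite -splitr mulrC divfK// gt_eqF.
Qed.

Definition ell : quasiBanach R s :=
  @QuasiBanach R s ell_type ell_norm ell_norm_ge0 ell_norm_eq0 ell_normZ
    ell_normD ell_complete.

End ell.

Section bases.
Context {R : realType} {s : scalar_kind} {X : quasiBanach R s}.
Local Notation K := (scalar R s).
Implicit Types (x : nat -> X) (xs : nat -> {linear X -> K^o}) (f z : X).

Definition qcontinuous (phi : X -> K) : Prop :=
  forall f (e : R), 0 < e -> exists2 d : R, 0 < d &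
    forall g, qnorm (g - f) < d -> modulus (phi g - phi f) < e.

Definition dual_norm (phi : X -> K) : \bar R :=
  ereal_sup [set (modulus (phi f))%:E | f in [set f : X | qnorm f <= 1]].

Definition dense_span x : Prop :=
  forall f (e : R), 0 < e -> exists n (a : nat -> K),
    qnorm (f - \sum_(k < n) a k *: x k) < e.

Definition biorthogonal x xs : Prop :=
  (forall n, qcontinuous (xs n)) /\
  (forall n k, xs n (x k) = (k == n)%:R).

(* xs is determined by x, since its terms are continuous and the span of x is
   dense. *)
Definition basis x xs : Prop := dense_span x /\ biorthogonal x xs.

Definition M_bounded x xs : Prop :=
  (ereal_sup (range (fun n => (qnorm (x n))%:E * dual_norm (xs n))) < +oo)%E.

Definition semi_normalized x : Prop :=
  (0 < ereal_inf (range (fun n => (qnorm (x n))%:E)))%E /\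
  (ereal_sup (range (fun n => (qnorm (x n))%:E)) < +oo)%E.

Definition supp xs f : set nat := [set n | xs n f != 0].

Definition greedy_set xs f (A : set nat) : Prop :=
  forall n k, A n -> ~ A k -> modulus (xs k f) <= modulus (xs n f).

Definition greedy_basis x : Prop :=
  exists xs, [/\ basis x xs, M_bounded x xs, semi_normalized x &
    exists2 C : R, 1 <= C &
      forall f (A : {fset nat}) z,
        greedy_set xs f [set` A] -> (supp xs z #<= [set` A])%card ->
        qnorm (f - \sum_(n <- A) xs n f *: x n) <= C * qnorm (f - z)].

End bases.

(* Main.v *)
(**
A greedy basis [x] is unconditional and democratic. The trace-type numbers
[mu n a = xs n (e_a) * coord a (x n)] sum to 1 over [n] for each coordinate [a],
and to 1 over [a] for each [n]; their absolute sums are bounded.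

If infinitely many [x n] carry a fixed part of their mass [sum_a mu n a] on
disjoint blocks of one row, then, flipping signs, sums of [N] basis vectors have
norm of order [N^(1/p)]; if they carry it on disjoint groups of rows, the order
is [N^(1/q)]. By democracy both cannot happen when [p != q].

Suppose that the mass of [x n] leaves every row. Then for coordinates [a] of row
0 the kernel [sum_n mu n a * mu n b], which is an average over signs of products
of two entries of bounded operators, lives on coordinates [b] in rows further and
further away. So some bounded operator carries [N] unit vectors of one row (an
l_p sequence) to [N] vectors in disjoint groups of rows (an l_q sequence) and
back, with comparable norms, and [p = q]. If instead the mass does not spread
over the rows, then the same argument, with one unit vector in each row, leads
from l_q to blocks of a single row.
*)
From HB Require Import structures.
From mathcomp Require Import all_boot all_order all_algebra finmap complex.
From mathcomp Require Import all_classical all_reals ereal topology normedtype.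
From mathcomp Require Import sequences exp ring lra.
Require Import Defs.

Set Implicit Arguments.
Unset Strict Implicit.
Unset Printing Implicit Defensive.

Import Order.TTheory GRing.Theory Num.Theory.
Import numFieldNormedType.Exports.

Local Open Scope ring_scope.

(** * Scalars and signs *)

Section scalars.
Context {R : realType} {s : scalar_kind}.
Local Notation K := (scalar R s).
Implicit Types a b : K.

Lemma modulusN a : modulus (- a) = modulus a.
Proof. by rewrite -mulN1r modulusM modulusN1 mul1r. Qed.

Lemma modulusB a b : modulus (a - b) = modulus (b - a).
Proof. by rewrite -modulusN opprB. Qed.

Lemma modulus_sign (e : bool) : modulus ((-1) ^+ e : K) = 1.
Proof. by case: e; rewrite ?expr1 ?expr0 ?modulusN1 ?modulus1. Qed.

Lemma modulus_nat n : modulus (n%:R : K) = n%:R.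
Proof.
case: s => /=; first by rewrite normr_nat.
elim: n => [|n _] /=; first exact: ComplexField.Normc.normc0.
rewrite -(rmorph_nat (real_complex R)) /=.
by rewrite expr0n addr0 sqrtr_sqr normr_nat.
Qed.

Lemma modulus_sum (I : Type) (r : seq I) (P : pred I) (F : I -> K) :
  modulus (\sum_(i <- r | P i) F i) <= \sum_(i <- r | P i) modulus (F i).
Proof.
elim/big_ind2: _ => //; first by rewrite modulus0.
move=> x1 x2 y1 y2 H1 H2; apply: le_trans (modulusD _ _) _; exact: lerD.
Qed.

Lemma modulus_ge_sub a b : modulus a - modulus b <= modulus (a - b).
Proof. by rewrite lerBlDr; apply: le_trans (modulusD _ _); rewrite subrK. Qed.

Definition of_real (r : R) : K :=
  match s with RealScalars => r | ComplexScalars => (r%:C)%C end.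

Lemma modulus_of_real r : modulus (of_real r) = `|r|.
Proof.
rewrite /of_real; case: s => //=.
by rewrite expr0n addr0 sqrtr_sqr.
Qed.

(** The nonnegative terms form one subsum and the negative terms another; each is at most [B] in
    absolute value. *)
Lemma sum_norm_le_subsums (I : eqType) (r : seq I) (F : I -> R) (B : R) :
  (forall P : pred I, `|\sum_(i <- r | P i) F i| <= B) ->
  \sum_(i <- r) `|F i| <= 2 * B.
Proof.
move=> H; rewrite (bigID (fun i => 0 <= F i)) /= mulr_natl mulr2n.
apply: lerD.
  apply: le_trans (H (fun i => 0 <= F i)); apply: le_trans (ler_norm _).
  by apply: ler_sum => i Fi; rewrite ger0_norm.
apply: le_trans (H (fun i => ~~ (0 <= F i))).
rewrite -normrN; apply: le_trans (ler_norm _).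
rewrite -sumrN; apply: ler_sum => i Fi; rewrite ltr0_norm// ltNge//.
Qed.

(** Real and imaginary parts inherit the bound on subsums, and each contributes [2 * B] by the real
    case. *)
Lemma sum_modulus_le_subsums (I : eqType) (r : seq I) (F : I -> K) (B : R) :
  (forall P : pred I, modulus (\sum_(i <- r | P i) F i) <= B) ->
  \sum_(i <- r) modulus (F i) <= 4 * B.
Proof.
case: s F => /= F H.
  have B0 : 0 <= B by apply: le_trans (H xpredT); exact: normr_ge0.
  by apply: le_trans (sum_norm_le_subsums H) _; rewrite ler_wpM2r// ler_nat.
have nRe (z : R[i]%C) : `|complex.Re z| <= ComplexField.Normc.normc z.
  case: z => x y /=; rewrite -sqrtr_sqr ler_sqrt ?addr_ge0 ?sqr_ge0//.
  by rewrite lerDl sqr_ge0.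
have nIm (z : R[i]%C) : `|complex.Im z| <= ComplexField.Normc.normc z.
  case: z => x y /=; rewrite -sqrtr_sqr ler_sqrt ?addr_ge0 ?sqr_ge0//.
  by rewrite lerDr sqr_ge0.
have nRI (z : R[i]%C) : ComplexField.Normc.normc z <=
    `|complex.Re z| + `|complex.Im z|.
  case: z => x y /=; rewrite -(@ler_pXn2r _ 2) ?nnegrE ?sqrtr_ge0 ?addr_ge0//.
  rewrite sqr_sqrtr ?addr_ge0 ?sqr_ge0// sqrrD !real_normK ?num_real//.
  by rewrite addrAC lerDl mulrn_wge0 ?mulr_ge0.
have SRe (P : pred I) : complex.Re (\sum_(i <- r | P i) F i) =
    \sum_(i <- r | P i) complex.Re (F i).
  exact: (raddf_sum (@complex.Re R : {additive R[i]%C -> R})).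
have SIm (P : pred I) : complex.Im (\sum_(i <- r | P i) F i) =
    \sum_(i <- r | P i) complex.Im (F i).
  exact: (raddf_sum (@complex.Im R : {additive R[i]%C -> R})).
apply: le_trans (ler_sum _ (fun i _ => nRI (F i))) _.
rewrite big_split /= (_ : 4 * B = 2 * B + 2 * B); last by ring.
apply: lerD; apply: sum_norm_le_subsums => P.
  by rewrite -SRe; apply: le_trans (nRe _) (H P).
by rewrite -SIm; apply: le_trans (nIm _) (H P).
Qed.

End scalars.

(** * Averaging over choices of signs *)

Section sign_choice.
Variable N : nat.
Implicit Types e : {ffun 'I_N -> bool}.

Definition flip_sign (k : 'I_N) e : {ffun 'I_N -> bool} :=
  [ffun l => if l == k then ~~ e l else e l].

Lemma flip_signK k : involutive (flip_sign k).
Proof.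
by move=> e; apply/ffunP => l; rewrite !ffunE; case: eqP => // _; rewrite negbK.
Qed.

(** Pairing [e] with [flip_sign k e] shows that each [k] in [I] is good for at least half of all
    [e]. Exchanging the two counts, some [e] is good for at least half of [I]. *)
Lemma sign_choice (I : {set 'I_N}) (good : 'I_N -> {ffun 'I_N -> bool} -> bool) :
  (forall k e, k \in I -> good k e || good k (flip_sign k e)) ->
  exists e, (#|I| <= 2 * #|[set k in I | good k e]|)%N.
Proof.
move=> H; apply: contrapT => /forallNP Hn.
have card_e : (0 < #|{ffun 'I_N -> bool}|)%N by apply/card_gt0P; exists [ffun=> true].
have lt1 : (\sum_(e : {ffun 'I_N -> bool}) 2 * #|[set k in I | good k e]| <
    \sum_(e : {ffun 'I_N -> bool}) #|I|)%N.
  have [e0 _] := card_gt0P card_e.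
  rewrite (bigD1 e0)//= [X in (_ < X)%N](bigD1 e0)//= -addSn.
  apply: leq_add; first by rewrite ltnNge; apply/negP/Hn.
  by apply: leq_sum => e _; apply: ltnW; rewrite ltnNge; apply/negP/Hn.
have cE e : #|[set k in I | good k e]| = (\sum_(k in I) (good k e : nat))%N.
  rewrite -sum1_card big_mkcond [RHS]big_mkcond /=; apply: eq_bigr => k _.
  by rewrite inE; case: (k \in I); case: (good k e).
move: lt1; rewrite ltnNge => /negP; apply.
under [leqRHS]eq_bigr do rewrite cE.
rewrite -big_distrr /= exchange_big /= [leqRHS]big_distrr /=.
rewrite sum_nat_const -mulnC -sum_nat_const.
apply: leq_sum => k kI; rewrite mul2n -addnn.
(* One of the two copies of the sum over [e] is reindexed by the flip, so that [e] meets its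
   partner. *)
rewrite [X in (_ <= _ + X)%N](reindex_inj (inv_inj (flip_signK k))) /=.
rewrite -big_split /= -[leqLHS]muln1 -sum_nat_const.
apply: leq_sum => e _; have := H k e kI.
by case: (good k e) => //= ->.
Qed.

End sign_choice.

Section random_signs.
Context {R : realType} {s : scalar_kind}.
Local Notation K := (scalar R s).
Variables (M : nat).
Implicit Types e : {ffun 'I_M -> bool}.

(** Off the diagonal, flipping one of the two signs shows that the sum over [e] equals its opposite;
    on the diagonal the signs square to 1. *)
Lemma sum_signs_quadratic (a : 'I_M -> 'I_M -> K) :
  \sum_(e : {ffun 'I_M -> bool}) \sum_n \sum_m (-1) ^+ e n * (-1) ^+ e m * a n m =
  #|{ffun 'I_M -> bool}|%:R * \sum_n a n n.
Proof.
rewrite exchange_big /= mulr_sumr; apply: eq_bigr => n _.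
rewrite exchange_big /= (bigD1 n)//= [X in _ + X]big1 ?addr0.
  under eq_bigr do rewrite -expr2 sqrr_sign mul1r.
  by rewrite sumr_const cardT mulr_natl -cardT.
move=> m mn; rewrite -mulr_suml.
set S := \sum_e _; suff -> : S = 0 by rewrite mul0r.
have SN : S = - S.
  rewrite {1}/S (reindex_inj (inv_inj (flip_signK m))) /= -sumrN.
  apply: eq_bigr => e _; rewrite !ffunE eqxx [n == m]eq_sym (negbTE mn).
  by rewrite signrN mulrN.
have : S *+ 2 = 0 by rewrite mulr2n {1}SN addNr.
by rewrite -mulr_natl => /eqP; rewrite mulf_eq0 pnatr_eq0 /= => /eqP.
Qed.

(** The mean over [e] of each quadratic form is its diagonal sum, of modulus at least [c]. Hence for
    some [e] the moduli add up to at least [c * N]. Forms below [c / 2] account for at most half of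
    this, and every other form for at most [B]. *)
Lemma quadratic_sign_choice (N : nat) (a : 'I_N -> 'I_M -> 'I_M -> K) (c B : R) :
  0 <= c ->
  (forall k e, modulus (\sum_n \sum_m (-1) ^+ e n * (-1) ^+ e m * a k n m) <= B) ->
  (forall k, c <= modulus (\sum_n a k n n)) ->
  exists e, c * N%:R <= 2 * B *
    #|[set k | c / 2 <= modulus (\sum_n \sum_m (-1) ^+ e n * (-1) ^+ e m * a k n m)]|%:R.
Proof.
move=> c0 HB Hc.
pose X k e := modulus (\sum_n \sum_m (-1) ^+ e n * (-1) ^+ e m * a k n m).
have card_e : (0 < #|{ffun 'I_M -> bool}|)%N by apply/card_gt0P; exists [ffun=> true].
have [e0 _] := card_gt0P card_e.
have [e He] : exists e, c * N%:R <= \sum_k X k e.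
  apply: contrapT => /forallNP Hn.
  have lt1 : \sum_e \sum_k X k e < \sum_(e : {ffun 'I_M -> bool}) c * N%:R.
    rewrite (bigD1 e0)//= [ltRHS](bigD1 e0)//=; apply: ltr_leD.
      by rewrite ltNge; apply/negP/Hn.
    by apply: ler_sum => e _; apply: ltW; rewrite ltNge; apply/negP/Hn.
  move: lt1; rewrite ltNge => /negP; apply.
  rewrite exchange_big /= sumr_const -[leLHS]mulr_natl mulrA.
  rewrite -[X in _ * X%:R]card_ord mulr_natr -sumr_const; apply: ler_sum => k _.
  apply: le_trans (modulus_sum _ _ _).
  by rewrite sum_signs_quadratic modulusM modulus_nat ler_wpM2l.
exists e; set G := [set k | _].
have X0 k : 0 <= X k e by exact: modulus_ge0.
have : \sum_k X k e <= B * #|G|%:R + (c / 2) * N%:R.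
  rewrite (bigID (fun k => k \in G)) /=; apply: lerD.
    by rewrite mulr_natr -sumr_const; apply: ler_sum => k _; exact: HB.
  apply: (@le_trans _ _ (\sum_(k < N | k \notin G) c / 2)).
    by apply: ler_sum => k; rewrite /G inE -ltNge => /ltW.
  rewrite mulr_natr -[X in _ <= _ *+ X]card_ord -sumr_const.
  rewrite [leRHS](bigID (fun k => k \in G)) /= lerDr; apply: sumr_ge0 => _ _.
  by rewrite divr_ge0.
by move/(le_trans He); lra.
Qed.

End random_signs.

(** * Unconditionality and democracy of greedy bases *)

Section greedy.
Context {R : realType} {s : scalar_kind} {X : quasiBanach R s}.
Local Notation K := (scalar R s).
Variables (x : nat -> X) (xs : nat -> {linear X -> K^o}).
Implicit Types (f g z : X) (r : seq nat).

Lemma semi_normalized_bounds : semi_normalized x ->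
  exists a b : R, 0 < a /\ forall n, a <= qnorm (x n) <= b.
Proof.
move=> [inf0 supoo].
have [a a0 Ha] : exists2 a : R, 0 < a & forall n, a <= qnorm (x n).
  have [y y0] : exists2 y, (0 < y)%E & ereal_inf (range (fun n => (qnorm (x n))%:E)) = y.
    by eexists; [exact: inf0|].
  case: y y0 => [a| |] // a0 Ea.
    exists a; first by rewrite -lte_fin.
    by move=> n; rewrite -lee_fin -Ea; apply: ereal_inf_lbound; exists n.
  have : (ereal_inf (range (fun n => (qnorm (x n))%:E)) <= (qnorm (x 0%N))%:E)%E.
    by apply: ereal_inf_lbound; exists 0%N.
  by rewrite Ea.
have [b Hb] : exists b : R, forall n, qnorm (x n) <= b.
  have ub n : ((qnorm (x n))%:E <= ereal_sup (range (fun n => (qnorm (x n))%:E)))%E.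
    by apply: ereal_sup_ubound; exists n.
  case: (ereal_sup _) supoo ub => [b| |] // _ ub.
    by exists b => n; rewrite -lee_fin.
  by have := ub 0%N.
by exists a, b; split => // n; rewrite Ha Hb.
Qed.

(** Dividing the bound on [qnorm (x n) * dual_norm (xs n)] by the lower bound [a] of [qnorm (x n)]
    makes the functionals uniformly bounded on the unit ball; homogeneity does the rest. *)
Lemma coef_bound : M_bounded x xs -> semi_normalized x ->
  exists2 D : R, 0 < D & forall n f, modulus (xs n f) <= D * qnorm f.
Proof.
move=> Mb /semi_normalized_bounds[a [b [a0 Hab]]].
have [B HB] : exists B : R, forall n, ((qnorm (x n))%:E * dual_norm (xs n) <= B%:E)%E.
  move: Mb; rewrite /M_bounded.
  have ub n : ((qnorm (x n))%:E * dual_norm (xs n) <=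
      ereal_sup (range (fun n => (qnorm (x n))%:E * dual_norm (xs n))))%E.
    by apply: ereal_sup_ubound; exists n.
  case: (ereal_sup _) ub => [B| |] // ub _.
    by exists B.
  by exists 0 => n; apply: le_trans (ub n) _; exact: leNye.
have unit_ball n f : qnorm f <= 1 -> a * modulus (xs n f) <= B.
  move=> f1; have /andP[Ha _] := Hab n.
  apply: (@le_trans _ _ (qnorm (x n) * modulus (xs n f))).
    by rewrite ler_wpM2r ?modulus_ge0.
  rewrite -lee_fin; apply: le_trans (HB n); rewrite EFinM.
  rewrite lee_wpmul2l ?lee_fin ?qnorm_ge0//.
  by apply: ereal_sup_ubound; exists f.
exists (a^-1 * (`|B| + 1)); first by rewrite mulr_gt0 ?invr_gt0// ltr_wpDl.
move=> n f; have [f0|fn0] := eqVneq (qnorm f) 0.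
  by rewrite (qnorm_eq0 f0) linear0 modulus0 qnorm0 mulr0.
have fp : 0 < qnorm f by rewrite lt_def fn0 qnorm_ge0.
have := unit_ball n (of_real (qnorm f)^-1 *: f).
rewrite qnormZ modulus_of_real ger0_norm ?invr_ge0 ?qnorm_ge0// mulVf// lexx.
move=> /(_ isT); rewrite linearZ /= modulusM modulus_of_real.
rewrite ger0_norm ?invr_ge0 ?qnorm_ge0// => H.
rewrite -ler_pdivrMr// -ler_pdivrMl ?invr_gt0// invrK [_ / _]mulrC.
by apply: le_trans H _; apply: le_trans (ler_norm _) _; rewrite lerDl.
Qed.

Hypothesis bio : forall n k, xs n (x k) = (k == n)%:R.

Lemma coef_sum (a : nat -> K) r m : uniq r ->
  xs m (\sum_(n <- r) a n *: x n) = if m \in r then a m else 0.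
Proof.
move=> ur; rewrite linear_sum /=.
have E n : xs m (a n *: x n) = if n == m then a n else 0.
  rewrite linearZ /= bio; case: (n == m); first exact: mulr1.
  exact: mulr0.
under eq_bigr do rewrite E.
rewrite -big_mkcond /=; case: ifPn => mr.
  have fE : [seq n <- r | n == m] = [:: m] by exact: filter_pred1_uniq.
  by rewrite -big_filter fE big_seq1.
by rewrite big_seq_cond big1// => n /andP[nr /eqP nm]; rewrite -nm nr in mr.
Qed.

Variable C : R.
Hypothesis C1 : 1 <= C.
Hypothesis greedy : forall f (A : {fset nat}) z,
  greedy_set xs f [set` A] -> (supp xs z #<= [set` A])%card ->
  qnorm (f - \sum_(n <- A) xs n f *: x n) <= C * qnorm (f - z).

(** The greedy inequality for lists: a combination over [r'] has its support in [r'], hence is an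
    admissible competitor. *)
Lemma greedy_seq f r (a : nat -> K) r' : uniq r -> uniq r' ->
  (size r' <= size r)%N ->
  (forall n k, n \in r -> k \notin r -> modulus (xs k f) <= modulus (xs n f)) ->
  qnorm (f - \sum_(n <- r) xs n f *: x n) <=
  C * qnorm (f - \sum_(n <- r') a n *: x n).
Proof.
move=> ur ur' rr' H.
have perm_r : perm_eq (enum_fset [fset n in r]%fset) r.
  by apply: uniq_perm (fset_uniq _) ur _ => n; rewrite !inE.
have perm_r' : perm_eq (enum_fset [fset n in r']%fset) r'.
  by apply: uniq_perm (fset_uniq _) ur' _ => n; rewrite !inE.
rewrite -(perm_big _ perm_r); apply: greedy.
  by move=> n k /=; rewrite !inE => nr /negP kr; apply: H.
apply: (@card_le_trans _ _ _ [set` [fset n in r']%fset]).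
  apply: subset_card_le => n; rewrite /supp /= coef_sum// !inE.
  by case: ifP => //; rewrite eqxx.
have /card_eq_fsetP e1 := erefl #|` [fset n in r]%fset|.
have /card_eq_fsetP e2 := erefl #|` [fset n in r']%fset|.
rewrite (card_le_eql e2) (card_le_eqr e1) card_le_II.
by rewrite (perm_size perm_r) (perm_size perm_r').
Qed.

Hypothesis bounded : exists2 D : R, 0 < D &
  forall n f, modulus (xs n f) <= D * qnorm f.

(* Adding a large multiple of [\sum_(n <- r) x n] makes [r] a greedy set, and
   that multiple is an admissible competitor. *)
Lemma suppression f r : uniq r ->
  qnorm (f - \sum_(n <- r) xs n f *: x n) <= C * qnorm f.
Proof.
move=> ur; have [D D0 HD] := bounded.
(* Every coefficient of [f] is at most [D * qnorm f], so after adding [t] those on [r] are at least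
   [D * qnorm f], while those off [r] are at most that. *)
have [t Ht] : exists t : nat, 2 * (D * qnorm f) <= t%:R.
  by exists (Num.bound (2 * (D * qnorm f))); apply/ltW/archi_boundP;
     rewrite !mulr_ge0 ?qnorm_ge0// ltW.
pose g := f + \sum_(n <- r) t%:R *: x n.
have xg m : xs m g = xs m f + (if m \in r then t%:R else 0).
  by rewrite /g linearD /= coef_sum.
have := @greedy_seq g r (fun=> t%:R) r ur ur (leqnn _).
rewrite [X in _ <= _ * qnorm X]addrK.
have -> : \sum_(n <- r) xs n g *: x n =
    \sum_(n <- r) t%:R *: x n + \sum_(n <- r) xs n f *: x n.
  rewrite addrC -big_split /=; apply: eq_big_seq => n nr.
  by rewrite xg nr scalerDl.
rewrite /g addrKA; apply => n k nr kr.
rewrite !xg nr (negbTE kr) addr0.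
rewrite -[xs n f]opprK addrC; apply: le_trans (modulus_ge_sub _ _).
rewrite modulus_nat modulusN lerBrDr.
by apply: le_trans Ht; rewrite mulr_natl mulr2n; apply: lerD; exact: HD.
Qed.

Lemma partial_sum_bound : exists2 B : R, 0 < B &
  forall f r, uniq r -> qnorm (\sum_(n <- r) xs n f *: x n) <= B * qnorm f.
Proof.
have [kappa k1 kD] := qnormD X; have k0 : 0 < kappa by exact: lt_le_trans k1.
exists (kappa * (1 + C)); first by rewrite mulr_gt0// addr_gt0// (lt_le_trans _ C1).
move=> f r ur; set S := \sum_(n <- r) _.
have -> : S = f + (S - f) by rewrite addrC subrK.
apply: le_trans (kD _ _) _; rewrite -mulrA ler_wpM2l// ?(ltW k0)//.
by rewrite mulrDl mul1r lerD2l qnormB suppression.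
Qed.

(** Unconditionality: the indices with sign [-1] and those with sign [1] give two partial sums. *)
Lemma multiplier_bound : exists2 B : R, 0 < B &
  forall f r (e : nat -> bool), uniq r ->
    qnorm (\sum_(n <- r) ((-1) ^+ e n * xs n f) *: x n) <= B * qnorm f.
Proof.
have [B B0 HB] := partial_sum_bound.
have [kappa k1 kD] := qnormD X; have k0 : 0 < kappa by exact: lt_le_trans k1.
exists (kappa * (B + B)); first by rewrite !mulr_gt0// addr_gt0.
move=> f r e ur; rewrite (bigID e) /=.
apply: le_trans (kD _ _) _; rewrite -mulrA ler_wpM2l// ?(ltW k0)// mulrDl.
apply: lerD.
  under eq_bigr => n en do rewrite en expr1 mulN1r scaleNr.
  by rewrite sumrN qnormN -big_filter; apply: HB; exact: filter_uniq.
under eq_bigr => n en do rewrite (negbTE en) expr0 mul1r.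
by rewrite -big_filter; apply: HB; exact: filter_uniq.
Qed.

(** For disjoint [r] and [r'], let [g] be the part of [f] on [r] plus the signed sum over [r']. Then
    [r] is a greedy set of [g] and removing it leaves the signed sum, while the competitor that
    removes the signed sum leaves the part of [f]. In general one passes through a third set
    disjoint from both. *)
Lemma democracy : exists2 B : R, 0 < B &
  forall f r r' (e : nat -> bool), uniq r -> uniq r' -> (size r' <= size r)%N ->
    (forall n, n \in r -> 1 <= modulus (xs n f)) ->
    qnorm (\sum_(n <- r') (-1) ^+ e n *: x n) <= B * qnorm f.
Proof.
have [B B0 HB] := partial_sum_bound; have C0 : 0 < C by exact: lt_le_trans C1.
have disj f r r' (e : nat -> bool) : uniq r -> uniq r' -> (size r' <= size r)%N ->
    (forall n, n \in r -> 1 <= modulus (xs n f)) ->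
    (forall n, n \in r' -> n \notin r) ->
    qnorm (\sum_(n <- r') (-1) ^+ e n *: x n) <= C * (B * qnorm f).
  move=> ur ur' sr Hr dr.
  pose g := \sum_(n <- r) xs n f *: x n + \sum_(n <- r') (-1) ^+ e n *: x n.
  have xg m : xs m g = if m \in r then xs m f
      else if m \in r' then (-1) ^+ e m else 0.
    rewrite /g linearD /= !coef_sum//; case: ifPn => mr; last by rewrite add0r.
    by case: ifPn => [/dr|]; rewrite ?mr// addr0.
  have := @greedy_seq g r (fun n => (-1) ^+ e n) r' ur ur' sr.
  rewrite [X in _ <= _ * qnorm X]addrK.
  have -> : \sum_(n <- r) xs n g *: x n = \sum_(n <- r) xs n f *: x n.
    by apply: eq_big_seq => n nr; rewrite xg nr.
  rewrite /g addrAC subrr add0r => H.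
  apply: le_trans (H _) _ => [n k nr kr|]; last by rewrite ler_wpM2l ?HB// ltW.
  rewrite !xg nr (negbTE kr); apply: le_trans (Hr _ nr).
  by case: ifP; rewrite ?modulus_sign ?modulus0.
exists (C * (B * (C * B))); first by rewrite !mulr_gt0.
move=> f r r' e ur ur' sr Hr.
(* Indices from [m] on avoid both [r] and [r']. *)
pose m := (\max_(n <- r ++ r') n).+1.
have mlt n : n \in r ++ r' -> (n < m)%N.
  by move=> nr; rewrite ltnS; apply: leq_bigmax_seq.
pose r3 := iota m (size r').
have H3 : qnorm (\sum_(n <- r3) (-1) ^+ false *: x n) <= C * (B * qnorm f).
  apply: (@disj f r r3 (fun=> false)) => //; rewrite ?iota_uniq ?size_iota//.
  move=> n; rewrite mem_iota => /andP[mn _]; apply/negP => nr.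
  have := mlt n; rewrite mem_cat nr => /(_ isT); by rewrite ltnNge mn.
apply: (@le_trans _ _ (C * (B * (C * (B * qnorm f))))); last by rewrite !mulrA.
apply: le_trans (ler_wpM2l (ltW C0) (ler_wpM2l (ltW B0) H3)).
apply: (@disj _ r3 r' e) => //; rewrite ?iota_uniq ?size_iota//.
  by move=> n nr3; rewrite coef_sum ?iota_uniq// nr3 expr0 modulus1.
move=> n nr'; rewrite mem_iota; have := mlt n.
by rewrite mem_cat nr' orbT => /(_ isT); rewrite ltnNge => /negbTE ->.
Qed.

Hypothesis dense : dense_span x.

(** A finite combination close to [f] is reproduced by all long partial sums, so subtracting it does
    not change the remainder; [suppression] bounds the remainder of the small difference [h]. *)
Lemma partial_sum_cvg f (e : R) : 0 < e -> exists N0, forall N, (N0 <= N)%N ->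
  qnorm (f - \sum_(n < N) xs n f *: x n) <= e.
Proof.
move=> e0; have C0 : 0 < C by exact: lt_le_trans C1.
have [m [a Ha]] := dense f (divr_gt0 e0 C0); exists m => N mN.
set h := f - _ in Ha.
have xh : h - \sum_(n <- iota 0 N) xs n h *: x n =
    f - \sum_(n <- iota 0 N) xs n f *: x n.
  rewrite /h; have -> : \sum_(k < m) a k *: x k = \sum_(k <- iota 0 m) a k *: x k.
    by rewrite -[m in iota 0 m]subn0 -/(index_iota 0 m) big_mkord.
  set g := \sum_(k <- iota 0 m) _.
  have -> : \sum_(n <- iota 0 N) xs n (f - g) *: x n =
     \sum_(n <- iota 0 N) xs n f *: x n - g.
    under eq_bigr do rewrite linearB scalerBl.
    rewrite sumrB; congr (_ - _).
    under eq_bigr do rewrite coef_sum ?iota_uniq//.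
    rewrite -(subnKC mN) iotaD big_cat /= [X in _ + X]big1_seq ?addr0.
      by apply: eq_big_seq => n ->.
    move=> n /andP[_]; rewrite !mem_iota add0n leq0n /= => /andP[mn _].
    by rewrite ltnNge mn scale0r.
  by rewrite opprB addrA subrK.
have -> : \sum_(n < N) xs n f *: x n = \sum_(n <- iota 0 N) xs n f *: x n.
  by rewrite -[N in iota 0 N]subn0 -/(index_iota 0 N) big_mkord.
rewrite -xh; apply: le_trans (suppression _ (iota_uniq _ _)) _.
by rewrite -ler_pdivlMl// mulrC ltW.
Qed.

Lemma coef_cvg0 f (e : R) : 0 < e ->
  exists N, forall n, (N <= n)%N -> modulus (xs n f) <= e.
Proof.
move=> e0; have [D D0 HD] := bounded.
have [m [a Ha]] := dense f (divr_gt0 e0 D0); exists m => n mn.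
have : modulus (xs n (f - \sum_(k < m) a k *: x k)) <= e.
  by apply: le_trans (HD _ _) _; rewrite -ler_pdivlMl// mulrC ltW.
rewrite linearB /= linear_sum /= big1 ?subr0// => k _.
have kn : (k == n :> nat) = false.
  by apply/negbTE; rewrite neq_ltn (leq_trans (ltn_ord k) mn).
by rewrite linearZ /= bio kn; exact: mulr0.
Qed.

End greedy.

(** * Families of coordinates spanning l_t *)

Section power_scale.
Context {R : realType}.
Implicit Types t : \bar R.

Definition einv t : R := if t is r%:E then r^-1 else 0.

Lemma einv_ge0 t : (0 < t)%E -> 0 <= einv t.
Proof. by case: t => [r| |] //=; rewrite lte_fin invr_ge0 => /ltW. Qed.

Lemma einv_inj t1 t2 : (0 < t1)%E -> (0 < t2)%E -> einv t1 = einv t2 -> t1 = t2.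
Proof.
case: t1 => [r1| |] //; case: t2 => [r2| |] //=; rewrite ?lte_fin.
- by move=> _ _ /invr_inj ->.
- by move=> r0 _ /eqP; rewrite invr_eq0 gt_eqF.
- by move=> _ r0 /esym/eqP; rewrite invr_eq0 gt_eqF.
Qed.

(* The norm of a sum of [n] unit vectors of l_t, with 1/oo = 0. *)
Definition npow t (n : nat) : R := n%:R `^ einv t.

Lemma npow_ge0 t n : 0 <= npow t n.
Proof. exact: powR_ge0. Qed.

Lemma npow_gt0 t n : (0 < n)%N -> 0 < npow t n.
Proof. by move=> n0; rewrite powR_gt0// ltr0n. Qed.

Lemma npow_le t (d : R) n m : (0 < t)%E -> 0 <= d -> n%:R <= d * m%:R ->
  npow t n <= d `^ einv t * npow t m.
Proof.
move=> t0 d0 nm; rewrite /npow -powRM//.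
by apply: ge0_ler_powR; rewrite ?nnegrE ?mulr_ge0 ?einv_ge0.
Qed.

Lemma npow_dominated t1 t2 (C : R) :
  (forall n, (0 < n)%N -> npow t1 n <= C * npow t2 n) -> einv t1 <= einv t2.
Proof.
move=> H; rewrite leNgt; apply/negP => lt21.
pose d := einv t1 - einv t2; have d0 : 0 < d by rewrite subr_gt0.
have H' n : (0 < n)%N -> n%:R `^ d <= C.
  move=> n0; have := H n n0; rewrite -ler_pdivrMr ?npow_gt0// /npow -powRN -powRD//.
  by rewrite implybE pnatr_eq0 -lt0n n0 orbT.
have C0 : 0 <= C by apply: le_trans (H' 1%N isT); exact: powR_ge0.
pose n := (Num.bound ((C + 1) `^ d^-1)).+1.
have : (C + 1) `^ d^-1 <= n%:R.
  apply/ltW; apply: (lt_le_trans (archi_boundP (powR_ge0 _ _))).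
  by rewrite ler_nat.
move=> /(ge0_ler_powR (ltW d0)); rewrite !nnegrE powR_ge0 ler0n => /(_ isT isT).
rewrite -powRrM mulVf ?gt_eqF// powRr1 ?addr_ge0// => H1.
by have := le_trans H1 (H' n isT); rewrite gerDl ler10.
Qed.

End power_scale.

Section sign_spread.
Context {R : realType} {s : scalar_kind} {X : quasiBanach R s}.

(* Flipping the sign of [v k] moves the sum by [2 v k], so one of the two
   signs makes [rho k] large. *)
Lemma sign_spread (N : nat) (I : {set 'I_N}) (v : 'I_N -> X)
    (rho : 'I_N -> X -> R) (kappa c : R) : 0 < kappa ->
  (forall k f g, rho k (f + g) <= kappa * (rho k f + rho k g)) ->
  (forall k a f, rho k (a *: f) = modulus a * rho k f) ->
  (forall k, k \in I -> c <= rho k (v k)) ->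
  exists e : {ffun 'I_N -> bool}, (#|I| <=
    2 * #|[set k in I | (c / kappa <= rho k (\sum_(l in I) (-1) ^+ e l *: v l))%R]|)%N.
Proof.
move=> k0 rhoD rhoZ Hc.
apply: (@sign_choice N I
  (fun k e => c / kappa <= rho k (\sum_(l in I) (-1) ^+ e l *: v l))%R) => k e kI.
apply: contrapT => /negP; rewrite negb_or -!ltNge => /andP[H1 H2].
set f := \sum_(l in I) _ in H1; set g := \sum_(l in I) _ in H2.
have E : f + (-1) *: g = ((-1) ^+ e k *+ 2) *: v k.
  rewrite scaleN1r /f /g -sumrB (bigD1 k)//= big1 ?addr0.
    by rewrite !ffunE eqxx signrN scaleNr opprK -scalerDl mulr2n.
  move=> l /andP[_ lk]; by rewrite !ffunE (negbTE lk) subrr.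
have := rhoD k f ((-1) *: g); rewrite E !rhoZ modulusN1 mul1r.
rewrite -mulr_natl modulusM modulus_sign mulr1 modulus_nat leNgt => /negP; apply.
apply: (@lt_le_trans _ _ (2 * c)); last by rewrite ler_wpM2l// Hc.
rewrite -ltr_pdivlMl// mulrC [2 * c]mulrC -mulrA [2 / _]mulrC mulrA.
by rewrite mulr_natr mulr2n ltrD.
Qed.

End sign_spread.

(** * Abstract coordinates of a mixed-norm space *)

Section coordinates.
Context {R : realType} {s : scalar_kind}.
Local Notation K := (scalar R s).

(* [linearZ] leaves the product in the regular module [K^o], where [ring] and
   the [mulr] lemmas do not see it. *)
Lemma functionalZ (X : quasiBanach R s) (phi : {linear X -> K^o}) (a : K) f :
  phi (a *: f) = a * phi f :> K.
Proof. exact: linearZ. Qed.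

Lemma functional_sum (X : quasiBanach R s) (phi : {linear X -> K^o})
    (I : Type) (r : seq I) (P : pred I) (F : I -> X) :
  phi (\sum_(i <- r | P i) F i) = \sum_(i <- r | P i) (phi (F i) : K) :> K.
Proof. exact: linear_sum. Qed.

Lemma functionalD (X : quasiBanach R s) (phi : {linear X -> K^o}) f g :
  phi (f + g) = (phi f : K) + phi g :> K.
Proof. exact: linearD. Qed.

(** Upper and lower l_t estimates for vectors carried by the blocks [B k]. The upper one may count
    all [N] indices, since the sets [I] that occur contain a fixed proportion of them. *)
Definition spans_ell (X : quasiBanach R s)
    (restr : (nat -> nat -> bool) -> {linear X -> X})
    (t : \bar R) (B : nat -> nat -> nat -> bool) : Prop :=
  (forall N (I : {set 'I_N}) (g : 'I_N -> X) (b : R), 0 <= b ->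
    (forall k, k \in I -> restr (B k) (g k) = g k /\ qnorm (g k) <= b) ->
    qnorm (\sum_(k in I) g k) <= b * npow t N) /\
  (forall N (I : {set 'I_N}) (h : X) (c : R), 0 <= c -> (0 < #|I|)%N ->
    (forall k, k \in I -> c <= qnorm (restr (B k) h)) ->
    c * npow t #|I| <= qnorm h).

Definition row_blocks (i0 : nat) (J : nat -> nat) (k i j : nat) : bool :=
  (i == i0) && (J k <= j < J k.+1)%N.

Definition blocks_of_rows (M : nat -> nat) (k i j : nat) : bool :=
  (M k <= i < M k.+1)%N.

(** The properties of l_q(l_p) on which the comparison of exponents rests, with [i] the row and [j]
    the place in the row. The two tail conditions express that finitely supported vectors are dense,
    which for an infinite index is the reason for c_0. *)
Record mixed_coordinates (p q : \bar R) (X : quasiBanach R s) := MixedCoordinates {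
  coord : nat -> nat -> {linear X -> K^o};
  restr : (nat -> nat -> bool) -> {linear X -> X};
  unitv : nat -> nat -> X;
  coord_inj : forall f g, (forall i j, coord i j f = coord i j g) -> f = g;
  coord_restr : forall i j B f,
    coord i j (restr B f) = if B i j then coord i j f else 0;
  coord_unitv : forall i j i' j',
    coord i j (unitv i' j') = ((i == i') && (j == j'))%:R;
  coord_le : forall i j f, modulus (coord i j f) <= qnorm f;
  unitv_le1 : forall i j, qnorm (unitv i j) <= 1;
  restr_le : forall B f, qnorm (restr B f) <= qnorm f;
  rows_tail : forall f (e : R), 0 < e -> exists M,
    qnorm (restr (fun i _ => M <= i)%N f) <= e;
  row_tail : forall i0 f (e : R), 0 < e -> exists J,
    qnorm (restr (fun i j => (i == i0) && (J <= j)%N) f) <= e;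
  row_blocks_ell : forall i0 J, {homo J : m n / (m <= n)%N} ->
    spans_ell restr p (row_blocks i0 J);
  blocks_of_rows_ell : forall M, {homo M : m n / (m <= n)%N} ->
    spans_ell restr q (blocks_of_rows M)
}.

End coordinates.

Arguments coord_inj {R s p q X} m {f g}.
Arguments coord_restr {R s p q X} m i j B f.
Arguments coord_unitv {R s p q X} m i j i' j'.
Arguments coord_le {R s p q X} m i j f.
Arguments unitv_le1 {R s p q X} m i j.
Arguments restr_le {R s p q X} m B f.
Arguments rows_tail {R s p q X} m f {e}.
Arguments row_tail {R s p q X} m i0 f {e}.
Arguments row_blocks_ell {R s p q X} m i0 J.
Arguments blocks_of_rows_ell {R s p q X} m M.

Section transfer.
Context {R : realType} {s : scalar_kind}.
Context {X : quasiBanach R s} (restr : (nat -> nat -> bool) -> {linear X -> X}).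
Hypothesis restr_le : forall B f, qnorm (restr B f) <= qnorm f.
Variables (t1 t2 : \bar R) (A B : nat -> nat -> nat -> bool).
Hypotheses (t1_gt0 : (0 < t1)%E) (t2_gt0 : (0 < t2)%E).
Hypotheses (A_ell : spans_ell restr t1 A) (B_ell : spans_ell restr t2 B).

Lemma operator_transfer (T : X -> X) (D b c kappa : R) N (I : {set 'I_N})
    (g : 'I_N -> X) : 0 < D -> 0 <= b -> 0 <= c -> 0 < kappa ->
  (forall f h : X, qnorm (f + h) <= kappa * (qnorm f + qnorm h)) ->
  (forall f h, T (f + h) = T f + T h) -> (forall a f, T (a *: f) = a *: T f) ->
  (forall f, qnorm (T f) <= D * qnorm f) -> (0 < #|I|)%N ->
  (forall k, k \in I -> restr (A k) (g k) = g k /\ qnorm (g k) <= b) ->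
  (forall k, k \in I -> c <= qnorm (restr (B k) (T (g k)))) ->
  c * npow t2 #|I| <= kappa * 2 `^ einv t2 * (D * b) * npow t1 N.
Proof.
move=> D0 b0 c0 k0 kD TD TZ Tle I0 HA HB.
have [e He] : exists e : {ffun 'I_N -> bool}, (#|I| <= 2 * #|[set k in I |
   (c / kappa <= qnorm (restr (B k) (T (\sum_(l in I) (-1) ^+ e l *: g l))))%R]|)%N.
  apply: (@sign_spread _ _ _ N I g (fun k f => qnorm (restr (B k) (T f)))) => //.
  - by move=> k f h; rewrite TD linearD.
  - by move=> k a f; rewrite TZ linearZ /= qnormZ.
set G := [set k in I | _] in He; set F := \sum_(l in I) _ in G He.
have G0 : (0 < #|G|)%N by rewrite -(ltn_pmul2l (isT : 0 < 2)%N) muln0 (leq_trans I0).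
have Fle : qnorm F <= b * npow t1 N.
  apply: A_ell.1 => // k kI; have [Ek Hk] := HA k kI; split.
    by rewrite linearZ /= Ek.
  by rewrite qnormZ modulus_sign mul1r.
have ck0 : 0 <= c / kappa by rewrite divr_ge0// ltW.
have low : c / kappa * npow t2 #|G| <= qnorm (T F).
  by apply: B_ell.2 => // k; rewrite inE => /andP[].
have := le_trans low (le_trans (Tle F) (ler_wpM2l (ltW D0) Fle)).
rewrite mulrAC ler_pdivrMr// => low'.
have IG : npow t2 #|I| <= 2 `^ einv t2 * npow t2 #|G|.
  by apply: npow_le => //; rewrite -natrM ler_nat.
apply: le_trans (ler_wpM2l c0 IG) _; rewrite mulrCA.
apply: le_trans (ler_wpM2l (powR_ge0 _ _) low') _.
by rewrite le_eqVlt; apply/orP; left; apply/eqP; ring.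
Qed.

End transfer.

(** * Equality of exponents from kernels bounded below *)

Section greedy_in_coordinates.
Context {R : realType} {s : scalar_kind}.
Local Notation K := (scalar R s).
Context {p q : \bar R} {X : quasiBanach R s} (cX : mixed_coordinates p q X).
Variables (x : nat -> X) (xs : nat -> {linear X -> K^o}) (D : R).
Hypothesis D0 : 0 < D.
Hypothesis multiplier_le : forall f r (e : nat -> bool), uniq r ->
  qnorm (\sum_(n <- r) ((-1) ^+ e n * xs n f) *: x n) <= D * qnorm f.

Local Notation restr := (restr cX).
Local Notation coord := (coord cX).
Local Notation unitv := (unitv cX).

Lemma restr_unitv (B : nat -> nat -> bool) i j : B i j -> restr B (unitv i j) = unitv i j.
Proof.
move=> Bij; apply: (coord_inj cX) => i' j'; rewrite coord_restr coord_unitv.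
by have [->|_] := eqVneq i' i; have [->|_] := eqVneq j' j; rewrite ?Bij//= mulr0n if_same.
Qed.

Lemma restr_id (B : nat -> nat -> bool) f : restr B (restr B f) = restr B f.
Proof.
by apply: (coord_inj cX) => i j; rewrite !coord_restr; case: (B i j).
Qed.

(** The mass that [x n] carries on [B]: it is additive in [B], and for a biorthogonal system the
    whole plane has mass [xs n (x n) = 1]. *)
Definition diag (n : nat) (B : nat -> nat -> bool) : K := xs n (restr B (x n)).

(* With [T e f = \sum_(n < N) (-1) ^+ e n * xs n f *: x n], this is the mean
   over the signs [e] of the [(i, j)] entry of [T e (restr B (T e (unitv i j)))]. *)
Definition kernel (N i j : nat) (B : nat -> nat -> bool) : K :=
  \sum_(n < N) xs n (unitv i j) * coord i j (x n) * diag n B.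

(** Since the kernel is a mean over signs, one sign operator [T] has large entries in
    [T (restr (B k) (T (unitv (i k) (j k))))] for a fixed proportion of the [k < N]. This [T]
    carries unit vectors in [A k] to [B k] and the resulting blocks back to [A k], so
    [operator_transfer] applies in both directions. *)
Lemma kernel_transfer (t1 t2 : \bar R) (A B : nat -> nat -> nat -> bool)
    (i j : nat -> nat) (c : R) : (0 < t1)%E -> (0 < t2)%E -> 0 < c ->
  spans_ell restr t1 A -> spans_ell restr t2 B ->
  (forall k, A k (i k) (j k)) ->
  (forall k, exists N0, forall N, (N0 <= N)%N ->
     c <= modulus (kernel N (i k) (j k) (B k))) ->
  einv t1 = einv t2.
Proof.
move=> t10 t20 c0 hA hB Aij Hc.
have [kappa k1 kD] := qnormD X; have k0 : 0 < kappa by exact: lt_le_trans k1.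
have key N : (0 < N)%N -> exists T : X -> X, exists I : {set 'I_N},
  [/\ (forall f h, T (f + h) = T f + T h), (forall a f, T (a *: f) = a *: T f),
   (forall f, qnorm (T f) <= D * qnorm f),
   c * N%:R <= 2 * (D * D) * #|I|%:R &
   forall k, k \in I -> c / 2 <= modulus (coord (i k) (j k)
      (T (restr (B k) (T (unitv (i k) (j k))))))].
  have /choice[N0 HN0] := Hc.
  (* The truncation is long enough for all [N] kernels to be at least [c]. *)
  pose S := (\max_(k < N) N0 k)%N.
  pose T (e : {ffun 'I_S -> bool}) f := \sum_(n < S) ((-1) ^+ e n * xs n f) *: x n.
  have TD e f h : T e (f + h) = T e f + T e h.
    rewrite /T -big_split /=; apply: eq_bigr => n _.
    by rewrite functionalD mulrDr scalerDl.
  have TZ e a f : T e (a *: f) = a *: T e f.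
    rewrite /T scaler_sumr; apply: eq_bigr => n _.
    by rewrite functionalZ mulrCA scalerA.
  have Tle e f : qnorm (T e f) <= D * qnorm f.
    pose e' n := if insub n is Some k then e k else false.
    have := multiplier_le f e' (iota_uniq 0 S).
    rewrite -[S in iota 0 S]subn0 -/(index_iota 0 S) big_mkord.
    by under eq_bigr do rewrite /e' valK.
  (* The entry is a quadratic form in the signs, and its diagonal sum is the kernel. *)
  have quad k e : coord (i k) (j k) (T e (restr (B k) (T e (unitv (i k) (j k))))) =
     \sum_n \sum_m (-1) ^+ e n * (-1) ^+ e m *
       (xs n (unitv (i k) (j k)) * xs m (restr (B k) (x n)) * coord (i k) (j k) (x m)).
    rewrite [T e (restr _ _)]/T functional_sum exchange_big /=; apply: eq_bigr => m _.
    rewrite functionalZ /T linear_sum functional_sum mulr_sumr mulr_suml.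
    by apply: eq_bigr => n _; rewrite linearZ functionalZ !mulrA [_ ^+ e m * _]mulrC.
  have quad_le (k : 'I_N) (e : {ffun 'I_S -> bool}) :
    modulus (\sum_n \sum_m (-1) ^+ e n * (-1) ^+ e m *
      (xs n (unitv (i k) (j k)) * xs m (restr (B k) (x n)) * coord (i k) (j k) (x m)))
      <= D * D.
    rewrite -quad; apply: le_trans (coord_le _ _ _ _) _.
    apply: le_trans (Tle _ _) _; rewrite ler_wpM2l ?(ltW D0)//.
    apply: le_trans (restr_le _ _ _) _; apply: le_trans (Tle _ _) _.
    by rewrite -[leRHS]mulr1 ler_wpM2l ?(ltW D0)// unitv_le1.
  have diag_ge (k : 'I_N) : c <= modulus (\sum_(n < S) xs n (unitv (i k) (j k)) *
      xs n (restr (B k) (x n)) * coord (i k) (j k) (x n)).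
    have -> : \sum_(n < S) xs n (unitv (i k) (j k)) * xs n (restr (B k) (x n)) *
       coord (i k) (j k) (x n) = kernel S (i k) (j k) (B k).
      by apply: eq_bigr => n _; rewrite mulrAC.
    by apply: HN0; exact: (leq_bigmax k).
  have [e He] := quadratic_sign_choice (ltW c0) quad_le diag_ge.
  exists (T e); eexists; split; [exact: TD|exact: TZ|exact: Tle|exact: He|].
  by move=> k; rewrite inE -quad.
pose d := 2 * (D * D) / c.
have d0 : 0 < d by rewrite divr_gt0// !mulr_gt0.
apply/eqP; rewrite eq_le; apply/andP; split.
  (* The way back, from [B] to [A]: the blocks have norm at most [D], and their images have an entry
     of size [c / 2] in [A k]. *)
  pose E := kappa * 2 `^ einv t1 * (D * D).
  apply: (@npow_dominated _ t1 t2 (d `^ einv t1 * (2 / c * E))) => N N0.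
  have [T [I [TD TZ Tle cardI HI]]] := key N N0.
  have I0 : (0 < #|I|)%N.
    rewrite lt0n; apply/eqP => I0; move: cardI; rewrite I0 mulr0 leNgt => /negP.
    by apply; rewrite mulr_gt0// ltr0n.
  have NI : N%:R <= d * #|I|%:R by rewrite /d mulrAC ler_pdivlMr// mulrC.
  apply: le_trans (npow_le t10 (ltW d0) NI) _.
  rewrite -mulrA ler_wpM2l ?powR_ge0//.
  have := @operator_transfer R s X restr t2 t1 B A t10 hB hA
    T D D (c / 2) kappa N I (fun k => restr (B k) (T (unitv (i k) (j k)))) D0 (ltW D0)
    _ k0 kD TD TZ Tle I0.
  rewrite -/E => HT; rewrite -[leRHS]mulrA -ler_pdivrMl ?divr_gt0// invf_div.
  apply: HT.
  - by rewrite divr_ge0// ltW.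
  - move=> k kI; rewrite restr_id; split=> //.
    apply: le_trans (restr_le _ _ _) _; apply: le_trans (Tle _) _.
    by rewrite -[leRHS]mulr1 ler_wpM2l ?(ltW D0)// unitv_le1.
  - move=> k kI; apply: le_trans (HI k kI) _; apply: le_trans (coord_le cX (i k) (j k) _).
    by rewrite coord_restr Aij.
(* The way out, from [A] to [B]: as [T] has norm at most [D], an entry [c / 2] after the second
   application forces norm [c / (2 * D)] on [B k] after the first. *)
pose E := kappa * 2 `^ einv t2 * (D * 1).
apply: (@npow_dominated _ t2 t1 (d `^ einv t2 * (2 * D / c * E))) => N N0.
have [T [I [TD TZ Tle cardI HI]]] := key N N0.
have I0 : (0 < #|I|)%N.
  rewrite lt0n; apply/eqP => I0; move: cardI; rewrite I0 mulr0 leNgt => /negP.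
  by apply; rewrite mulr_gt0// ltr0n.
have NI : N%:R <= d * #|I|%:R by rewrite /d mulrAC ler_pdivlMr// mulrC.
apply: le_trans (npow_le t20 (ltW d0) NI) _.
rewrite -mulrA ler_wpM2l ?powR_ge0//.
have := @operator_transfer R s X restr t1 t2 A B t20 hA hB
  T D 1 (c / (2 * D)) kappa N I (fun k => unitv (i k) (j k)) D0 ler01
  _ k0 kD TD TZ Tle I0.
rewrite -/E => HT; rewrite -[leRHS]mulrA -ler_pdivrMl ?divr_gt0 ?mulr_gt0// invf_div.
apply: HT.
- by rewrite divr_ge0 ?mulr_ge0// ltW.
- by move=> k kI; rewrite restr_unitv// unitv_le1.
- move=> k kI; rewrite invfM mulrA ler_pdivrMr// [leRHS]mulrC; apply: le_trans (Tle _).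
  by apply: le_trans (HI k kI) _; exact: coord_le.
Qed.

End greedy_in_coordinates.

(** * Comparison of the exponents *)

(** Iterated choice for gliding humps: each step takes an index beyond the previous one and a block
    that starts where the previous block ended. *)
Lemma subsequence_extraction (P : nat -> nat -> nat -> Prop) :
  (forall J k0, exists k J', [/\ (k0 <= k)%N, (J <= J')%N & P k J J']) ->
  exists kk J : nat -> nat, [/\ {homo kk : m n / (m < n)%N},
    {homo J : m n / (m <= n)%N} & forall l, P (kk l) (J l) (J l.+1)].
Proof.
move=> H.
have /choice[F HF] (a : nat * nat) : exists b : nat * nat,
    [/\ (a.1 <= b.1)%N, (a.2 <= b.2)%N & P b.1 a.2 b.2].
  by have [k [J' HkJ]] := H a.2 a.1; exists (k, J').
(* The successor makes the indices strictly increasing. The start [(0, 0)] supplies the first block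
   end but no index, whence the shift between the two sequences below. *)
pose G a := F (a.1.+1, a.2); pose st l := iter l G (0%N, 0%N).
have HG l : [/\ ((st l).1 < (st l.+1).1)%N, ((st l).2 <= (st l.+1).2)%N &
    P (st l.+1).1 (st l).2 (st l.+1).2] by exact: (HF (_, _)).
exists (fun l => (st l.+1).1), (fun l => (st l).2); split.
- by apply: homo_ltn => [|l]; [exact: ltn_trans|have [] := HG l.+1].
- by apply: homo_leq => [||l]; [exact: leqnn|exact: leq_trans|have [] := HG l].
- by move=> l; have [] := HG l.
Qed.

Section no_greedy.
Context {R : realType} {s : scalar_kind}.
Local Notation K := (scalar R s).
Context {p q : \bar R} {X : quasiBanach R s} (cX : mixed_coordinates p q X).
Variables (x : nat -> X) (xs : nat -> {linear X -> K^o}) (D : R).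
Hypothesis D0 : 0 < D.
Hypothesis coef_le : forall n f, modulus (xs n f) <= D * qnorm f.
Hypothesis vec_le : forall n, qnorm (x n) <= D.
Hypothesis multiplier_le : forall f r (e : nat -> bool), uniq r ->
  qnorm (\sum_(n <- r) ((-1) ^+ e n * xs n f) *: x n) <= D * qnorm f.
Hypothesis partial_le : forall f r, uniq r ->
  qnorm (\sum_(n <- r) xs n f *: x n) <= D * qnorm f.
Hypothesis democracy_le :
  forall f r r' (e : nat -> bool), uniq r -> uniq r' -> (size r' <= size r)%N ->
    (forall n, n \in r -> 1 <= modulus (xs n f)) ->
    qnorm (\sum_(n <- r') (-1) ^+ e n *: x n) <= D * qnorm f.
Hypothesis bio : forall n k, xs n (x k) = (k == n)%:R.
Hypothesis expansion : forall f (e : R), 0 < e -> exists N0, forall N, (N0 <= N)%N ->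
  qnorm (f - \sum_(n < N) xs n f *: x n) <= e.
Hypothesis coef0 : forall f (e : R), 0 < e ->
  exists N, forall n, (N <= n)%N -> modulus (xs n f) <= e.
Hypotheses (p0 : (0 < p)%E) (q0 : (0 < q)%E).

Local Notation restr := (restr cX).
Local Notation coord := (coord cX).
Local Notation unitv := (unitv cX).
Local Notation diag := (diag cX x xs).
Local Notation kernel := (kernel cX x xs).

Lemma big_iota (V : nmodType) N (F : nat -> V) :
  \sum_(n <- iota 0 N) F n = \sum_(n < N) F n.
Proof. by rewrite -[N in iota 0 N]subn0 -/(index_iota 0 N) big_mkord. Qed.

(** * Norms of signed sums of basis vectors *)

Section fundamental_function.
Variables (t : \bar R) (B : nat -> nat -> nat -> bool) (n : nat -> nat) (c : R).
Hypotheses (t0 : (0 < t)%E) (B_ell : spans_ell restr t B) (c0 : 0 < c).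
Hypothesis n_inj : injective n.
Hypothesis diag_ge : forall k, c <= modulus (diag (n k) (B k)).

(** Since [xs (n k)] has norm at most [D], mass [c] on [B k] means that [x (n k)] has norm at least
    [c / D] there. Good signs keep this, up to [kappa], on half of the blocks. *)
Lemma fundamental_lower : exists2 C : R, 0 < C & forall N, (0 < N)%N ->
  exists e : nat -> bool,
    npow t N <= C * qnorm (\sum_(m <- [seq n k | k <- iota 0 N]) (-1) ^+ e m *: x m).
Proof.
have [kappa k1 kD] := qnormD X; have k0 : 0 < kappa by exact: lt_le_trans k1.
exists (2 `^ einv t * (D * kappa / c)) => [|N N0].
  by rewrite mulr_gt0 ?powR_gt0// divr_gt0// mulr_gt0.
have [e He] : exists e : {ffun 'I_N -> bool}, (#|[set: 'I_N]| <=
    2 * #|[set k in [set: 'I_N] | (c / D / kappa <=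
    qnorm (restr (B k) (\sum_(l in [set: 'I_N]) (-1) ^+ e l *: x (n l))))%R]|)%N.
  apply: (@sign_spread _ _ _ N [set: 'I_N] (fun k => x (n k))
    (fun k f => qnorm (restr (B k) f)) kappa (c / D)) => //.
  - by move=> k f g; rewrite linearD.
  - by move=> k a f; rewrite linearZ /= qnormZ.
  - move=> k _; rewrite ler_pdivrMr// mulrC; apply: le_trans (coef_le _ _).
    exact: diag_ge.
(* The signs are moved from positions [k] to basis indices [n k], consistently because [n] is
   injective. *)
pose e' m := [exists k : 'I_N, (n k == m) && e k]; exists e'.
have e'E (k : 'I_N) : e' (n k) = e k.
  apply/existsP/idP => [[l /andP[/eqP/n_inj/ord_inj ->]] //|ek].
  by exists k; rewrite eqxx.
have -> : \sum_(m <- [seq n k | k <- iota 0 N]) (-1) ^+ e' m *: x m =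
    \sum_(l in [set: 'I_N]) (-1) ^+ e l *: x (n l).
  rewrite big_map big_iota; apply: eq_big => [l|l _]; first by rewrite inE.
  by rewrite e'E.
move: He; rewrite cardsT card_ord.
set F := \sum_(l in _) _; set G := [set k in _ | _] => He.
have G0 : (0 < #|G|)%N by rewrite -(ltn_pmul2l (isT : 0 < 2)%N) muln0 (leq_trans N0).
have low : c / D / kappa * npow t #|G| <= qnorm F.
  apply: B_ell.2 => //; first by rewrite !divr_ge0// ltW.
  by move=> k; rewrite inE => /andP[_].
have NG : npow t N <= 2 `^ einv t * npow t #|G|.
  by apply: npow_le => //; rewrite -natrM ler_nat.
apply: le_trans NG _; rewrite -mulrA ler_wpM2l ?powR_ge0//.
rewrite -ler_pdivrMl ?divr_gt0 ?mulr_gt0// invf_div invfM mulrA.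
exact: low.
Qed.

(** The vector [f] is a signed sum of the pieces [restr (B k) (x (n k))], which obeys the upper l_t
    estimate. Good signs make at least half of its coefficients at [n k] as large as [c / kappa],
    and rescaling makes them at least 1. *)
Lemma fundamental_upper : exists2 C : R, 0 < C & forall N, (0 < N)%N ->
  exists f r, [/\ uniq r, (N <= 2 * size r)%N,
    (forall m, m \in r -> 1 <= modulus (xs m f)) & qnorm f <= C * npow t N].
Proof.
have [kappa k1 kD] := qnormD X; have k0 : 0 < kappa by exact: lt_le_trans k1.
exists (kappa / c * D) => [|N N0]; first by rewrite mulr_gt0// divr_gt0.
pose v (k : 'I_N) := restr (B k) (x (n k)).
have [e He] : exists e : {ffun 'I_N -> bool}, (#|[set: 'I_N]| <=
    2 * #|[set k in [set: 'I_N] | (c / kappa <=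
    modulus (xs (n k) (\sum_(l in [set: 'I_N]) (-1) ^+ e l *: v l)))%R]|)%N.
  apply: (@sign_spread _ _ _ N [set: 'I_N] v
    (fun k f => modulus (xs (n k) f)) kappa c) => //.
  - move=> k f g; rewrite functionalD; apply: le_trans (modulusD _ _) _.
    by rewrite ler_peMl// addr_ge0// modulus_ge0.
  - by move=> k a f; rewrite functionalZ modulusM.
  - by move=> k _; exact: diag_ge.
move: He; rewrite cardsT card_ord.
set F := \sum_(l in _) _; set G := [set k in _ | _] => He.
exists (of_real (kappa / c) *: F), [seq n k | k : 'I_N in G]; split.
- by rewrite map_inj_uniq ?enum_uniq// => k l /n_inj/ord_inj.
- by rewrite size_map -cardE.
- move=> m /mapP[k]; rewrite mem_enum inE => /andP[_ Hk] ->.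
  rewrite functionalZ modulusM modulus_of_real ger0_norm ?divr_ge0 ?(ltW k0) ?(ltW c0)//.
  by rewrite -ler_pdivrMl ?divr_gt0// invf_div mulr1.
rewrite qnormZ modulus_of_real ger0_norm ?divr_ge0 ?(ltW k0) ?(ltW c0)// -[leRHS]mulrA.
apply: ler_wpM2l; first by rewrite divr_ge0 ?(ltW k0) ?(ltW c0).
apply: B_ell.1 => [|k _]; first exact: ltW.
rewrite linearZ /= restr_id; split=> //.
rewrite qnormZ modulus_sign mul1r; apply: le_trans (restr_le _ _ _) _; exact: vec_le.
Qed.

End fundamental_function.

(** Democracy compares the lower estimate along [n1] with the upper estimate along [n2]. The latter
    is taken for [2 * N] vectors, since only half of their coefficients are known to be large. *)
Lemma fundamental_compare (t1 t2 : \bar R) (B1 B2 : nat -> nat -> nat -> bool)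
    (n1 n2 : nat -> nat) (c1 c2 : R) : (0 < t1)%E -> (0 < t2)%E ->
  0 < c1 -> 0 < c2 -> spans_ell restr t1 B1 -> spans_ell restr t2 B2 ->
  injective n1 -> injective n2 ->
  (forall k, c1 <= modulus (diag (n1 k) (B1 k))) ->
  (forall k, c2 <= modulus (diag (n2 k) (B2 k))) -> einv t1 <= einv t2.
Proof.
move=> t10 t20 c10 c20 B1l B2l n1i n2i H1 H2.
have [C1 C10 low] := fundamental_lower t10 B1l c10 n1i H1.
have [C2 C20 up] := fundamental_upper B2l c20 n2i H2.
apply: (@npow_dominated _ t1 t2 (C1 * (D * (C2 * 2 `^ einv t2)))) => N N0.
have [e He] := low N N0.
have [|f [r [ur sr Hr Hf]]] := up (2 * N)%N; first by rewrite muln_gt0.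
apply: le_trans He _; rewrite -!mulrA ler_wpM2l ?(ltW C10)//.
apply: (@le_trans _ _ (D * qnorm f)).
  apply: (@democracy_le f r) => //.
    by rewrite map_inj_uniq ?iota_uniq.
  by rewrite size_map size_iota -(leq_pmul2l (isT : 0 < 2)%N).
rewrite ler_wpM2l ?(ltW D0)//; apply: le_trans Hf _; rewrite ler_wpM2l ?(ltW C20)//.
by apply: npow_le => //; rewrite natrM.
Qed.

(** * Trace-type numbers and kernels *)

Definition mu n i j : K := xs n (unitv i j) * coord i j (x n).

Definition row_from (i0 J i j : nat) := (i == i0) && (J <= j)%N.
Definition row_upto (i0 J i j : nat) := (i == i0) && (j < J)%N.
Definition rows_from (M i j : nat) := (M <= i)%N.
Definition rows_upto (M i j : nat) := (i < M)%N.

(** The two conditions together say that [B] is the disjoint union of [B1] and [B2]. *)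
Lemma restr_split (B B1 B2 : nat -> nat -> bool) (f : X) :
  (forall i j, B i j = B1 i j (+) B2 i j) ->
  (forall i j, ~~ (B1 i j && B2 i j)) ->
  restr B f = restr B1 f + restr B2 f.
Proof.
move=> HB H; apply: (coord_inj cX) => i j; rewrite functionalD !coord_restr HB.
by have := H i j; case: (B1 i j); case: (B2 i j); rewrite ?addr0 ?add0r.
Qed.

Lemma diag_split (B B1 B2 : nat -> nat -> bool) n :
  (forall i j, B i j = B1 i j (+) B2 i j) ->
  (forall i j, ~~ (B1 i j && B2 i j)) -> diag n B = diag n B1 + diag n B2.
Proof. by move=> HB H; rewrite /diag (restr_split _ HB H) functionalD. Qed.

Lemma kernel_split (B B1 B2 : nat -> nat -> bool) N i j :
  (forall i j, B i j = B1 i j (+) B2 i j) ->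
  (forall i j, ~~ (B1 i j && B2 i j)) ->
  kernel N i j B = kernel N i j B1 + kernel N i j B2.
Proof.
move=> HB H; rewrite /kernel -big_split /=; apply: eq_bigr => n _.
by rewrite (diag_split _ HB H) mulrDr.
Qed.

Lemma diag_rows_upto n M :
  diag n (rows_upto M) = \sum_(i0 < M) diag n (row_from i0 0).
Proof.
elim: M => [|M IH].
  rewrite big_ord0 /diag; suff -> : restr (rows_upto 0) (x n) = 0 by rewrite linear0.
  by apply: (coord_inj cX) => i j; rewrite coord_restr linear0.
rewrite big_ord_recr /= -IH; apply: diag_split => i j;
  by rewrite /rows_upto /row_from ?ltnS leq0n andbT; case: ltngtP.
Qed.

Lemma kernel_rows_upto N i j M :
  kernel N i j (rows_upto M) = \sum_(i0 < M) kernel N i j (row_from i0 0).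
Proof.
rewrite /kernel exchange_big /=; apply: eq_bigr => n _.
by rewrite diag_rows_upto mulr_sumr.
Qed.

Lemma diag_le n B : modulus (diag n B) <= D * D.
Proof.
apply: le_trans (coef_le _ _) _; rewrite ler_wpM2l ?(ltW D0)//.
exact: le_trans (restr_le _ _ _) (vec_le _).
Qed.

(** Each subsum over [n] is the [(i, j)] coordinate of a partial sum of [unitv i j], hence at most
    [D]. *)
Lemma mu_mass N i j : \sum_(n < N) modulus (mu n i j) <= 4 * D.
Proof.
rewrite -(big_iota N (fun n => modulus (mu n i j))); apply: sum_modulus_le_subsums => P.
have -> : \sum_(n <- iota 0 N | P n) mu n i j =
    coord i j (\sum_(n <- [seq n <- iota 0 N | P n]) xs n (unitv i j) *: x n).
  rewrite functional_sum big_filter; apply: eq_bigr => n _.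
  by rewrite functionalZ.
apply: le_trans (coord_le _ _ _ _) _.
apply: le_trans (partial_le _ (filter_uniq _ (iota_uniq _ _))) _.
by rewrite -[leRHS]mulr1 ler_wpM2l ?(ltW D0)// unitv_le1.
Qed.

Lemma mu_tail i j (e : R) : 0 < e -> exists N0, forall N, (N0 <= N)%N ->
  \sum_(N0 <= n < N) modulus (mu n i j) <= e.
Proof.
move=> e0; pose S := series (fun n => modulus (mu n i j)).
have Snd : nondecreasing_seq S.
  by apply/nondecreasing_series => n _ _; exact: modulus_ge0.
have Sc : cvgn S.
  apply: nondecreasing_is_cvgn Snd _; exists (4 * D) => _ [N _ <-].
  by rewrite /S /series /= big_mkord mu_mass.
have /cvgrPdist_le /(_ e e0)[N0 _ HN0] := Sc.
exists N0 => N NN; have -> : \sum_(N0 <= n < N) modulus (mu n i j) = S N - S N0.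
  by rewrite sub_series_geq.
have := HN0 N0 (leqnn N0); have H := nondecreasing_cvgn_le Snd Sc.
rewrite ger0_norm ?subr_ge0 ?H// => le_e.
by apply: le_trans le_e; rewrite lerD2r H.
Qed.

(** The terms added after [N0] amount to at most [D * D] times a tail of the absolute sum of [mu].
    The threshold does not depend on [B], which allows [B] to be chosen afterwards. *)
Lemma kernel_stable i j (e : R) : 0 < e -> exists N0, forall N N' B,
  (N0 <= N)%N -> (N <= N')%N ->
  modulus (kernel N i j B) - e <= modulus (kernel N' i j B).
Proof.
move=> e0; have DD0 : 0 < D * D by rewrite mulr_gt0.
have [N0 HN0] := mu_tail i j (divr_gt0 e0 DD0).
exists N0 => N N' B N0N NN'; rewrite lerBlDr -lerBlDl.
apply: le_trans (modulus_ge_sub _ _) _; rewrite modulusB.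
have -> : kernel N' i j B - kernel N i j B =
    \sum_(N <= n < N') mu n i j * diag n B.
  have E M : kernel M i j B = \sum_(0 <= n < M) mu n i j * diag n B.
    by rewrite big_mkord.
  by rewrite !E (@big_cat_nat _ _ _ N 0 N')//= addrAC subrr add0r.
apply: le_trans (modulus_sum _ _ _) _.
apply: (@le_trans _ _ (\sum_(N <= n < N') modulus (mu n i j) * (D * D))).
  by apply: ler_sum => n _; rewrite modulusM ler_wpM2l ?modulus_ge0 ?diag_le.
rewrite -mulr_suml -ler_pdivlMr//; apply: le_trans (HN0 N' (leq_trans N0N NN')).
rewrite [leRHS](@big_cat_nat _ _ _ N)//= lerDr.
by apply: sumr_ge0 => n _; exact: modulus_ge0.
Qed.

(** On the whole plane every [diag] is 1, so the kernel is the [(i, j)] coordinate of a partial sum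
    of [unitv i j], which tends to 1. *)
Lemma kernel_full i j (e : R) : 0 < e -> exists N0, forall N, (N0 <= N)%N ->
  1 - e <= modulus (kernel N i j (rows_from 0)).
Proof.
move=> e0; have [N0 HN0] := expansion (unitv i j) e0; exists N0 => N /HN0 H.
have E : kernel N i j (rows_from 0) =
    1 - coord i j (unitv i j - \sum_(n < N) xs n (unitv i j) *: x n).
  rewrite linearB functional_sum coord_unitv !eqxx opprB addrC subrK.
  apply: eq_bigr => n _; rewrite functionalZ /diag.
  suff -> : restr (rows_from 0) (x n) = x n by rewrite bio eqxx mulr1.
  by apply: (coord_inj cX) => i' j'; rewrite coord_restr.
rewrite E; apply: le_trans (modulus_ge_sub _ _); rewrite modulus1 lerD2l lerN2.
by apply: le_trans H; exact: coord_le.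
Qed.

(** Terms with [n >= n0] have a small [diag] and total mass at most [4 * D], so they contribute at
    most [e / 2]. The finitely many others tend to 0 as [k] grows; [d] is chosen so that they
    contribute at most [e / 2] too. *)
Lemma kernel_small (B : nat -> nat -> bool) (i j : nat -> nat) (e : R) : 0 < e ->
  (exists n0, forall n, (n0 <= n)%N -> modulus (diag n B) <= e / (8 * D)) ->
  (forall n d, 0 < d -> exists k0, forall k, (k0 <= k)%N ->
     modulus (mu n (i k) (j k)) <= d) ->
  exists k0, forall k, (k0 <= k)%N -> forall N, modulus (kernel N (i k) (j k) B) <= e.
Proof.
move=> e0 [n0 Hn0] Hmu.
pose d := e / (2 * n0.+1%:R * (D * D)).
have d0 : 0 < d by rewrite divr_gt0// !mulr_gt0// ltr0n.
have /choice[k0 Hk0] n := Hmu n d d0.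
exists (\max_(n < n0) k0 n)%N => k Hk N.
apply: le_trans (modulus_sum _ _ _) _.
apply: (@le_trans _ _ (\sum_(n < N) ((n < n0)%:R * (d * (D * D)) +
    modulus (mu n (i k) (j k)) * (e / (8 * D))))).
  apply: ler_sum => n _; rewrite modulusM.
  have [nn0|n0n] := ltnP n n0.
    rewrite mul1r -[leLHS]addr0; apply: lerD.
      apply: ler_pM; rewrite ?modulus_ge0 ?diag_le//; apply: Hk0.
      by apply: leq_trans Hk; exact: (leq_bigmax (Ordinal nn0)).
    by rewrite mulr_ge0 ?modulus_ge0// divr_ge0 ?mulr_ge0// ltW.
  by rewrite mul0r add0r ler_wpM2l ?modulus_ge0// Hn0.
rewrite big_split /= -!mulr_suml.
have cnt : \sum_(n < N) (n < n0)%:R <= n0%:R :> R.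
  have {}cnt : (\sum_(n < N) (n < n0) <= minn N n0)%N.
    elim: N => [|N IH]; first by rewrite big_ord0.
    rewrite big_ord_recr /=; apply: leq_trans (leq_add IH (leqnn _)) _.
    case: ltnP => Nn0; first by rewrite !(minn_idPl _) ?addn1// ltnW.
    by rewrite !(minn_idPr _) ?addn0// leqW.
  by rewrite -natr_sum ler_nat; apply: leq_trans cnt (geq_minr _ _).
apply: (@le_trans _ _ (n0%:R * (d * (D * D)) + (4 * D) * (e / (8 * D)))).
  apply: lerD; apply: ler_wpM2r => //.
  - exact: mulr_ge0 (ltW d0) (mulr_ge0 (ltW D0) (ltW D0)).
  - by rewrite divr_ge0 ?mulr_ge0 ?(ltW D0) ?(ltW e0).
  - exact: mu_mass.
rewrite [leRHS]splitr; apply: lerD.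
  have -> : d * (D * D) = e / 2 / n0.+1%:R.
    by rewrite /d; field; rewrite ?pnatr_eq0 ?gt_eqF.
  rewrite mulrCA ler_piMr ?divr_ge0 ?(ltW e0)//.
  by rewrite ler_pdivrMr ?ltr0n// mul1r ler_nat.
rewrite le_eqVlt; apply/orP; left; apply/eqP; field; by rewrite gt_eqF.
Qed.

Lemma mu_row i0 n (d : R) : 0 < d -> exists k0, forall k, (k0 <= k)%N ->
  modulus (mu n i0 k) <= d.
Proof.
move=> d0; have [J HJ] := row_tail cX i0 (x n) (divr_gt0 d0 D0).
exists J => k Jk; rewrite /mu modulusM.
have dE : d = D * (d / D) by rewrite mulrC divfK// gt_eqF.
rewrite [leRHS]dE.
apply: ler_pM; rewrite ?modulus_ge0//; last first.
  apply: le_trans HJ; apply: le_trans (coord_le cX i0 k _).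
  by rewrite coord_restr eqxx Jk.
by apply: le_trans (coef_le _ _) _; rewrite -[leRHS]mulr1 ler_wpM2l ?(ltW D0)// unitv_le1.
Qed.

Lemma mu_rows n (d : R) : 0 < d -> exists k0, forall k, (k0 <= k)%N ->
  modulus (mu n k 0) <= d.
Proof.
move=> d0; have [J HJ] := rows_tail cX (x n) (divr_gt0 d0 D0).
exists J => k Jk; rewrite /mu modulusM.
have dE : d = D * (d / D) by rewrite mulrC divfK// gt_eqF.
rewrite [leRHS]dE.
apply: ler_pM; rewrite ?modulus_ge0//; last first.
  apply: le_trans HJ; apply: le_trans (coord_le cX k 0 _).
  by rewrite coord_restr Jk.
by apply: le_trans (coef_le _ _) _; rewrite -[leRHS]mulr1 ler_wpM2l ?(ltW D0)// unitv_le1.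
Qed.

Lemma restr_row_upto i0 J f :
  restr (row_upto i0 J) f = \sum_(j < J) (coord i0 j f : K) *: unitv i0 j.
Proof.
apply: (coord_inj cX) => i j; rewrite coord_restr functional_sum /row_upto.
under eq_bigr do rewrite functionalZ coord_unitv.
case: (eqVneq i i0) => [->|_] /=; last by rewrite big1// => l _; rewrite mulr0.
have [jJ|Jj] := ltnP j J; last first.
  rewrite big1// => l _; rewrite gtn_eqF ?mulr0//.
  exact: leq_trans (ltn_ord l) Jj.
rewrite (bigD1 (Ordinal jJ))//= eqxx mulr1 big1 ?addr0// => l lj.
by rewrite [j == l]eq_sym (_ : (l == j :> nat) = false) ?mulr0//; apply: negbTE.
Qed.

(** A finite piece of a row is spanned by finitely many unit vectors, whose coefficients tend to
    0. *)
Lemma diag_row_upto i0 J (e : R) : 0 < e -> exists n0, forall n, (n0 <= n)%N ->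
  modulus (diag n (row_upto i0 J)) <= e.
Proof.
move=> e0; have d0 : 0 < e / (D * J.+1%:R) by rewrite divr_gt0 ?mulr_gt0 ?ltr0n.
have /choice[n0 Hn0] j := coef0 (unitv i0 j) d0.
exists (\max_(j < J) n0 j)%N => n Hn.
rewrite /diag restr_row_upto functional_sum.
apply: le_trans (modulus_sum _ _ _) _.
apply: (@le_trans _ _ (\sum_(j < J) D * (e / (D * J.+1%:R)))).
  apply: ler_sum => j _; rewrite functionalZ modulusM.
  apply: ler_pM; rewrite ?modulus_ge0//.
    exact: le_trans (coord_le _ _ _ _) (vec_le _).
  by apply: Hn0; apply: leq_trans Hn; exact: (leq_bigmax j).
rewrite sumr_const card_ord -[leLHS]mulr_natr.
have -> : D * (e / (D * J.+1%:R)) * J%:R = e * (J%:R / J.+1%:R).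
  have : J.+1%:R != 0 :> R by rewrite pnatr_eq0.
  by move: (J.+1%:R : R) => m m0; field; rewrite m0 gt_eqF.
by rewrite ler_piMr ?(ltW e0)// ler_pdivrMr ?ltr0n// mul1r ler_nat.
Qed.

(** * Gliding humps: cutting tails into blocks *)

Definition vanishing (W : nat -> nat -> nat -> bool) :=
  forall f (e : R), 0 < e -> exists M, forall J, (M <= J)%N ->
    qnorm (restr (W J) f) <= e.

Lemma restr_le_sub (B1 B2 : nat -> nat -> bool) f :
  (forall i j, B1 i j -> B2 i j) -> qnorm (restr B1 f) <= qnorm (restr B2 f).
Proof.
move=> H; suff -> : restr B1 f = restr B1 (restr B2 f) by exact: restr_le.
apply: (coord_inj cX) => i j; rewrite !coord_restr.
by case: ifP => // /H ->.
Qed.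

Lemma vanishing_rows_from : vanishing rows_from.
Proof.
move=> f e e0; have [M HM] := rows_tail cX f e0; exists M => J MJ.
apply: le_trans HM; apply: restr_le_sub => i j; exact: leq_trans.
Qed.

Lemma vanishing_row_from i0 : vanishing (row_from i0).
Proof.
move=> f e e0; have [M HM] := row_tail cX i0 f e0; exists M => J MJ.
apply: le_trans HM; apply: restr_le_sub => i j /andP[-> Jj].
exact: leq_trans Jj.
Qed.

Lemma diag_vanishing W n (e : R) : vanishing W -> 0 < e ->
  exists M, forall J, (M <= J)%N -> modulus (diag n (W J)) <= e.
Proof.
move=> HW e0; have [M HM] := HW (x n) _ (divr_gt0 e0 D0); exists M => J /HM H.
by apply: le_trans (coef_le _ _) _; rewrite mulrC -ler_pdivlMr.
Qed.

Lemma kernel_vanishing W N i j (e : R) : vanishing W -> 0 < e ->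
  exists M, forall J, (M <= J)%N -> modulus (kernel N i j (W J)) <= e.
Proof.
move=> HW e0; have d0 : 0 < e / (4 * D) by rewrite divr_gt0// mulr_gt0.
have /choice[M HM] n := diag_vanishing n HW d0.
exists (\max_(n < N) M n)%N => J HJ.
apply: le_trans (modulus_sum _ _ _) _.
apply: (@le_trans _ _ (\sum_(n < N) modulus (mu n i j) * (e / (4 * D)))).
  apply: ler_sum => n _; rewrite modulusM ler_wpM2l ?modulus_ge0//.
  by apply: HM; apply: leq_trans HJ; exact: (leq_bigmax n).
rewrite -mulr_suml mulrA ler_pdivrMr ?mulr_gt0// mulrC ler_wpM2l ?(ltW e0)//.
exact: mu_mass.
Qed.

Definition peels (W : nat -> nat -> nat -> bool)
    (Bl : nat -> nat -> nat -> nat -> bool) : Prop :=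
  forall J J', (J <= J')%N ->
    (forall i j, W J i j = Bl J J' i j (+) W J' i j) /\
    (forall i j, ~~ (Bl J J' i j && W J' i j)).

Definition row_block (i0 J J' i j : nat) := (i == i0) && (J <= j < J')%N.
Definition rows_block (M M' i j : nat) := (M <= i < M')%N.

Lemma peels_row i0 : peels (row_from i0) (row_block i0).
Proof.
move=> J J' JJ'; split=> i j; rewrite /row_from /row_block; case: (i == i0) => //=.
  by case: (leqP J' j) => [J'j|]; rewrite ?andbF ?andbT ?addbF// (leq_trans JJ' J'j).
by rewrite ltnNge -andbA andNb andbF.
Qed.

Lemma peels_rows : peels rows_from rows_block.
Proof.
move=> J J' JJ'; split=> i j; rewrite /rows_from /rows_block.
  by case: (leqP J' i) => [J'i|]; rewrite ?andbF ?andbT ?addbF// (leq_trans JJ' J'i).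
by rewrite ltnNge -andbA andNb andbF.
Qed.

(** A far tail carries at most [c / 2] of the mass, which leaves [c / 2] to the block before it. *)
Lemma diag_peel W Bl n J (c : R) : vanishing W -> peels W Bl -> 0 < c ->
  c <= modulus (diag n (W J)) ->
  exists2 J', (J <= J')%N & c / 2 <= modulus (diag n (Bl J J')).
Proof.
move=> HW HB c0 Hc; have c20 : 0 < c / 2 by rewrite divr_gt0.
have [M HM] := diag_vanishing n HW c20.
exists (maxn J M); first exact: leq_maxl.
have H := HM _ (leq_maxr J M); have [s1 s2] := HB J _ (leq_maxl J M).
have E := diag_split n s1 s2.
have := modulusD (diag n (Bl J (maxn J M))) (diag n (W (maxn J M))).
rewrite -E; lra.
Qed.

(** One quarter of [c] is lost to the far tail and one quarter to the passage from [N] to [N']. *)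
Lemma kernel_peel W Bl N i j J (c : R) : vanishing W -> peels W Bl -> 0 < c ->
  c <= modulus (kernel N i j (W J)) ->
  (forall N' B, (N <= N')%N ->
     modulus (kernel N i j B) - c / 4 <= modulus (kernel N' i j B)) ->
  exists2 J', (J <= J')%N & forall N', (N <= N')%N ->
     c / 2 <= modulus (kernel N' i j (Bl J J')).
Proof.
move=> HW HB c0 Hc stable; have c40 : 0 < c / 4 by rewrite divr_gt0.
have [M HM] := kernel_vanishing N i j HW c40.
exists (maxn J M); first exact: leq_maxl.
have H := HM _ (leq_maxr J M); have [s1 s2] := HB J _ (leq_maxl J M).
have E := kernel_split N i j s1 s2 => N' NN'.
have := modulusD (kernel N i j (Bl J (maxn J M))) (kernel N i j (W (maxn J M))).
have := stable N' (Bl J (maxn J M)) NN'.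
rewrite -E; lra.
Qed.

(** Infinitely many basis vectors keep mass [c] in each tail. For one row, whose finite pieces lose
    their mass by [diag_row_upto], this amounts to a fixed mass in the whole row. *)
Definition heavy (W : nat -> nat -> nat -> bool) : Prop := exists2 c : R, 0 < c &
  forall J n0, exists2 n, (n0 <= n)%N & c <= modulus (diag n (W J)).

Lemma heavy_blocks W Bl : vanishing W -> peels W Bl -> heavy W ->
  exists (c : R) (n J : nat -> nat), [/\ 0 < c, injective n,
    {homo J : l m / (l <= m)%N} &
    forall k, c <= modulus (diag (n k) (Bl (J k) (J k.+1)))].
Proof.
move=> HW HB [c c0 Hc].
have [|n [J [nhomo Jhomo H]]] := @subsequence_extraction
    (fun n J J' => c / 2 <= modulus (diag n (Bl J J'))).
  move=> J n0; have [n n0n Hn] := Hc J n0.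
  by have [J' JJ' HJ'] := diag_peel HW HB c0 Hn; exists n, J'.
exists (c / 2), n, J; split=> //; first by rewrite divr_gt0.
move=> k l nkl; apply/eqP; case: ltngtP => // /nhomo; rewrite nkl ltnn//.
Qed.

Lemma kernel_blocks (W : nat -> nat -> nat -> bool) Bl (i j : nat -> nat) (c : R) :
  vanishing W -> peels W Bl -> 0 < c ->
  (forall J k0, exists2 k, (k0 <= k)%N & exists N,
     c <= modulus (kernel N (i k) (j k) (W J)) /\
     forall N' B, (N <= N')%N ->
       modulus (kernel N (i k) (j k) B) - c / 4 <= modulus (kernel N' (i k) (j k) B)) ->
  exists kk J : nat -> nat, [/\ {homo kk : l m / (l < m)%N},
    {homo J : l m / (l <= m)%N} & forall l, exists N0, forall N, (N0 <= N)%N ->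
      c / 2 <= modulus (kernel N (i (kk l)) (j (kk l)) (Bl (J l) (J l.+1)))].
Proof.
move=> HW HB c0 H; apply: subsequence_extraction
  (fun k J J' => exists N0, forall N, (N0 <= N)%N ->
     c / 2 <= modulus (kernel N (i k) (j k) (Bl J J'))) _ => J k0.
have [k k0k [N [HN stable]]] := H J k0.
have [J' JJ' HJ'] := kernel_peel HW HB c0 HN stable.
by exists k, J'; split=> //; exists N.
Qed.

(** * The two cases: every row is light, or some row is heavy *)

Lemma ltn_homo_leq (f : nat -> nat) :
  {homo f : m n / (m < n)%N} -> {homo f : m n / (m <= n)%N}.
Proof. by move=> H m n; rewrite leq_eqVlt => /orP[/eqP->//|/H/ltnW]. Qed.

Lemma rows_split M :
  (forall i j, rows_from 0 i j = rows_upto M i j (+) rows_from M i j) /\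
  (forall i j, ~~ (rows_upto M i j && rows_from M i j)).
Proof. by split=> i j; rewrite /rows_from /rows_upto ?leq0n; case: ltnP. Qed.

Lemma row_split i0 M :
  (forall i j, row_from i0 0 i j = row_upto i0 M i j (+) row_from i0 M i j) /\
  (forall i j, ~~ (row_upto i0 M i j && row_from i0 M i j)).
Proof.
by split=> i j; rewrite /row_from /row_upto ?leq0n; case: (i == i0); case: ltnP.
Qed.

(** The mass leaves every finite set of rows. The kernel at [(0, k)] is therefore carried, for large
    [k], by rows beyond any given [J], and a gliding hump places it in disjoint groups of rows. *)
Lemma light_rows_exponents : (forall i0, ~ heavy (row_from i0)) -> einv p = einv q.
Proof.
move=> light.
have light_upto M (e : R) : 0 < e -> exists n0, forall n, (n0 <= n)%N ->
    modulus (diag n (rows_upto M)) <= e.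
  move=> e0; have [d dE] : exists d, d = e / M.+1%:R by eexists.
  have d0 : 0 < d / 2 by rewrite dE !divr_gt0.
  have /choice[n0 Hn0] i0 : exists n0, forall n, (n0 <= n)%N ->
      modulus (diag n (row_from i0 0)) <= d.
    (* Mass above [d] in row [i0] for arbitrarily large [n] would make the row heavy, as its first
       [J] places eventually hold at most [d / 2]. *)
    apply: contrapT => /forallNP Hn; apply: (light i0); exists (d / 2) => // J m0.
    have [n1 Hn1] := diag_row_upto i0 J d0.
    have /existsNP[n /not_implyP[Hmn /negP]] := Hn (maxn m0 n1).
    rewrite -ltNge => Hbig; move: Hmn; rewrite geq_max => /andP[mn /Hn1 Hsmall].
    exists n => //; have [s1 s2] := row_split i0 J.
    have := modulusD (diag n (row_upto i0 J)) (diag n (row_from i0 J)).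
    rewrite -(diag_split n s1 s2); lra.
  exists (\max_(i0 < M) n0 i0)%N => n Hn; rewrite diag_rows_upto.
  apply: le_trans (modulus_sum _ _ _) _.
  apply: (@le_trans _ _ (\sum_(i0 < M) d)).
    apply: ler_sum => i0 _; apply: Hn0; apply: leq_trans Hn.
    exact: (leq_bigmax i0).
  rewrite sumr_const card_ord -[leLHS]mulr_natr dE mulrAC -mulrA ler_piMr ?(ltW e0)//.
  by rewrite ler_pdivrMr ?ltr0n// mul1r ler_nat.
have c0 : 0 < 1 / 2 :> R by rewrite divr_gt0.
have [|kk [J [kkhomo Jhomo H]]] := @kernel_blocks rows_from rows_block
    (fun=> 0%N) (fun k => k) (1 / 2) vanishing_rows_from peels_rows c0.
  move=> J k0; have e0 : 0 < 1 / 8 :> R by rewrite divr_gt0.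
  have d0 : 0 < 1 / 8 / (8 * D) by rewrite divr_gt0// mulr_gt0.
  have [k1 Hk1] := kernel_small e0 (light_upto J _ d0) (fun n d d0 => mu_row 0 n d0).
  exists (maxn k0 k1); first exact: leq_maxl.
  have {Hk1} Hk := Hk1 _ (leq_maxr k0 k1); move: (maxn k0 k1) Hk => k Hk.
  have [N0 HN0] := kernel_stable 0 k e0; have [N1 HN1] := kernel_full 0 k e0.
  exists (maxn N0 N1); split.
    (* The whole kernel is at least [1 - 1 / 8] and the first [J] rows hold at most [1 / 8] of it,
       so more than [1 / 2] remains. *)
    have := HN1 _ (leq_maxr N0 N1); have := Hk (maxn N0 N1).
    have [s1 s2] := rows_split J; rewrite (kernel_split _ _ _ s1 s2) => H1 H2.
    have := modulusD (kernel (maxn N0 N1) 0 k (rows_upto J))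
      (kernel (maxn N0 N1) 0 k (rows_from J)).
    by lra.
  move=> N' B NN'; have := HN0 _ N' B (leq_maxl N0 N1) NN'; lra.
have c40 : 0 < 1 / 2 / 2 :> R by rewrite divr_gt0.
apply: (@kernel_transfer _ _ _ _ _ cX x xs D D0 multiplier_le p q
  (row_blocks 0 kk) (blocks_of_rows J) (fun=> 0%N) kk (1 / 2 / 2)) => //.
- exact: row_blocks_ell (ltn_homo_leq kkhomo).
- exact: blocks_of_rows_ell Jhomo.
- by move=> k; rewrite /row_blocks eqxx leqnn /= kkhomo.
Qed.

(** If the tails of rows are heavy as well, democracy equates the two growth rates. Otherwise
    finitely many rows hold almost all the mass, and the kernels at [(k, 0)] concentrate on one of
    them. *)
Lemma heavy_row_exponents i0 : heavy (row_from i0) -> einv p = einv q.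
Proof.
move=> hrow.
have [c1 [n1 [J1 [c10 n1i J1h H1]]]] :=
  heavy_blocks (@vanishing_row_from i0) (@peels_row i0) hrow.
have [hrows|lrows] := pselect (heavy rows_from).
  have [c2 [n2 [J2 [c20 n2i J2h H2]]]] :=
    heavy_blocks vanishing_rows_from peels_rows hrows.
  have pl := row_blocks_ell cX i0 J1 J1h; have ql := blocks_of_rows_ell cX J2 J2h.
  apply/eqP; rewrite eq_le; apply/andP; split.
    exact: (fundamental_compare p0 q0 c10 c20 pl ql n1i n2i H1 H2).
  exact: (fundamental_compare q0 p0 c20 c10 ql pl n2i n1i H2 H1).
have e0 : 0 < 1 / 8 :> R by rewrite divr_gt0.
have d0 : 0 < 1 / 8 / (8 * D) by rewrite divr_gt0// mulr_gt0.
have [M [n0 HM]] : exists M n0, forall n, (n0 <= n)%N ->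
    modulus (diag n (rows_from M)) <= 1 / 8 / (8 * D).
  apply: contrapT => /forallNP Hn; apply: lrows; exists (1 / 8 / (8 * D)) => // M n0.
  have /forallNP/(_ n0)/existsNP[n /not_implyP[nn0 /negP]] := Hn M.
  by rewrite -ltNge => /ltW; exists n.
have [k1 Hk1] := kernel_small e0 (ex_intro _ n0 HM) (fun n d d0 => mu_rows n d0).
(* The share of one row if the first [M] rows are to hold [1 / 2] together; the successor covers
   [M = 0]. *)
pose c : R := 1 / 2 / M.+1%:R.
have c0 : 0 < c by rewrite !divr_gt0.
have c40 : 0 < c / 4 / 4 by rewrite !divr_gt0.
have /choice[N0 HN0] k := kernel_stable k 0 c40.
have /choice[N1 HN1] k := kernel_full k 0 e0.
pose N k := maxn (N0 k) (N1 k).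
(* Pigeonhole: if each of the first [M] rows eventually held at most [c], the whole kernel would be
   at most [1 / 2 + 1 / 8], against [1 - 1 / 8]. *)
have [i1 Hi1] : exists i1, forall k0, exists2 k, (k0 <= k)%N &
    c <= modulus (kernel (N k) k 0 (row_from i1 0)).
  apply: contrapT => /forallNP Hn.
  have /choice[k2 Hk2] i1 : exists k2, forall k, (k2 <= k)%N ->
      modulus (kernel (N k) k 0 (row_from i1 0)) <= c.
    have /existsNP[k2 Hk2] := Hn i1; exists k2 => k k2k; apply: contrapT => /negP.
    by rewrite -ltNge => /ltW Hc; apply: Hk2; exists k.
  pose k := maxn k1 (\max_(i1 < M) k2 i1).
  have Hk := Hk1 k (leq_maxl _ _) (N k); have Hf := HN1 k (N k) (leq_maxr _ _).
  have [s1 s2] := rows_split M; move: Hf; rewrite (kernel_split _ _ _ s1 s2) => Hf.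
  have Hup : modulus (kernel (N k) k 0 (rows_upto M)) <= 1 / 2.
    rewrite kernel_rows_upto; apply: le_trans (modulus_sum _ _ _) _.
    apply: (@le_trans _ _ (\sum_(i1 < M) c)).
      apply: ler_sum => i1 _; apply: Hk2; apply: leq_trans (leq_maxr _ _).
      exact: (leq_bigmax i1).
    rewrite sumr_const card_ord -[leLHS]mulr_natr /c mulrAC -mulrA ler_piMr//.
    by rewrite ler_pdivrMr ?ltr0n// mul1r ler_nat.
  have := modulusD (kernel (N k) k 0 (rows_upto M)) (kernel (N k) k 0 (rows_from M)).
  by lra.
have c20 : 0 < c / 2 by rewrite divr_gt0.
have d20 : 0 < c / 2 / (8 * D) by rewrite divr_gt0// mulr_gt0.
have [|kk [J [kkhomo Jhomo H]]] := @kernel_blocks (row_from i1) (row_block i1)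
    (fun k => k) (fun=> 0%N) (c / 2) (@vanishing_row_from i1) (@peels_row i1) c20.
  move=> J k0.
  (* For large [k] the first [J] places of row [i1] hold at most [c / 2], so the tail of the row
     keeps [c / 2]. *)
  have [k3 Hk3] := kernel_small c20 (diag_row_upto i1 J d20) (fun n d d0 => mu_rows n d0).
  have [k] := Hi1 (maxn k0 k3); rewrite geq_max => /andP[k0k k3k] Hk.
  exists k => //; exists (N k); split.
    have [s1 s2] := row_split i1 J; move: Hk; rewrite (kernel_split _ _ _ s1 s2) => Hk.
    have := modulusD (kernel (N k) k 0 (row_upto i1 J))
      (kernel (N k) k 0 (row_from i1 J)).
    have := Hk3 k k3k (N k); lra.
  move=> N' B NN'; have := HN0 k (N k) N' B (leq_maxl _ _) NN'; lra.
have c220 : 0 < c / 2 / 2 by rewrite divr_gt0.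
apply/esym; apply: (@kernel_transfer _ _ _ _ _ cX x xs D D0 multiplier_le q p
  (blocks_of_rows kk) (row_blocks i1 J) kk (fun=> 0%N) (c / 2 / 2)) => //.
- exact: blocks_of_rows_ell (ltn_homo_leq kkhomo).
- exact: row_blocks_ell Jhomo.
- by move=> k; rewrite /blocks_of_rows leqnn /= kkhomo.
Qed.

Theorem greedy_exponents : p = q.
Proof.
apply: einv_inj => //; have [[i0 hrow]|light] := pselect (exists i0, heavy (row_from i0)).
  exact: heavy_row_exponents hrow.
by apply: light_rows_exponents; apply/forallNP.
Qed.

End no_greedy.

(** * Coordinates of the mixed-norm space *)

Section lq_blocks.
Local Open Scope classical_set_scope.
Local Open Scope ring_scope.
Context {R : realType}.
Implicit Types (q : \bar R) (u v w : nat -> R).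

Lemma lq_norm_le q v (B : R) : (0 < q)%E -> 0 <= B -> in_lq q v ->
  (forall r, q = r%:E -> forall n, \sum_(k < n) v k `^ r <= B `^ r) ->
  (forall k, v k <= B) -> lq_norm q v <= B.
Proof.
case: q => [r| |//] q0 B0 cv Hr Hoo; last first.
  by apply: ge_sup; [exists (v 0%N), 0%N|move=> _ [n _ <-]; exact: Hoo].
rewrite lte_fin in q0; apply: (lq_of_bound q0 B0 _).2 => n.
by rewrite /series /= big_mkord; exact: Hr.
Qed.

Lemma lq_mono q u v : (0 < q)%E -> (forall k, 0 <= u k) ->
  (forall k, u k <= v k) -> in_lq q v ->
  in_lq q u /\ lq_norm q u <= lq_norm q v.
Proof.
move=> q0 u0 uv cv; have v0 k : 0 <= v k by exact: le_trans (uv k).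
have nv0 := lq_norm_ge0 q0 v0 cv.
case: q q0 cv nv0 => [r| |//] q0 cv nv0.
  apply: lq_of_bound => // n; apply: le_trans (series_le_lq_norm n _ cv) => //.
  apply: ler_sum => k _; rewrite lte_fin in q0.
  by apply: ge0_ler_powR; rewrite ?nnegrE ?(ltW q0).
split; last first.
  apply: ge_sup; first by exists (u 0%N), 0%N.
  by move=> _ [n _ <-]; apply: le_trans (uv n) (c0_le_sup n cv).
apply: (@squeeze_cvgr _ _ _ _ (fun=> 0) v) => //; last exact: cvg_cst.
by apply: nearW => n; rewrite u0 uv.
Qed.

Lemma lq_tail q u (e : R) : (0 < q)%E -> (forall k, 0 <= u k) -> in_lq q u ->
  0 < e -> exists M, lq_norm q (fun k => if (M <= k)%N then u k else 0) <= e.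
Proof.
move=> q0 u0 cu e0.
case: q q0 cu => [r| |//] q0 cu; last first.
  have /cvgrPdist_le /(_ e e0)[M _ HM] := cu; exists M.
  apply: ge_sup; first by eexists; exists 0%N.
  move=> _ [n _ <-]; case: ifP => [/HM|_]; last exact: ltW.
  by rewrite /= sub0r normrN ger0_norm.
rewrite lte_fin in q0; have er0 : 0 < e `^ r by rewrite powR_gt0.
have /cvgrPdist_le /(_ _ er0)[M _ HM] := cu; exists M.
have ge0 k : 0 <= (if (M <= k)%N then u k else 0) by case: ifP.
apply: (lq_of_bound q0 (ltW e0) _).2 => n.
pose S := series (fun k => u k `^ r).
have SM : S M + series (fun k => (if (M <= k)%N then u k else 0) `^ r) n <= S (maxn M n).
  rewrite /S /series /= [leRHS](@big_cat_nat _ _ _ M)//= ?leq_maxl// lerD2l.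
  rewrite [leRHS](_ : _ = \sum_(0 <= k < maxn M n) (if (M <= k)%N then u k else 0) `^ r).
    rewrite [leRHS](@big_cat_nat _ _ _ n)//= ?leq_maxr// lerDl.
    by apply: sumr_ge0 => k _; exact: powR_ge0.
  have Z : \sum_(0 <= k < M) (if (M <= k)%N then u k else 0) `^ r = 0.
    rewrite big_nat big1// => k /andP[_ kM].
    by rewrite leqNgt kM /= powR0// gt_eqF.
  rewrite [RHS](@big_cat_nat _ _ _ M)//= ?leq_maxl// Z add0r.
  by apply: eq_big_nat => k /andP[-> _].
have H := HM M (leqnn M); have Hlim := nondecreasing_cvgn_le (series_powR_nd r u) cu.
move: H; rewrite /= ger0_norm ?subr_ge0 ?Hlim// lerBlDl => H.
rewrite -(lerD2l (S M)); apply: le_trans SM _; apply: le_trans H.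
exact: Hlim.
Qed.

Lemma lq_supp1 q u i : (0 < q)%E -> (forall k, 0 <= u k) -> in_lq q u ->
  (forall k, k != i -> u k = 0) -> lq_norm q u = u i.
Proof.
move=> q0 u0 cu H; apply/eqP; rewrite eq_le le_lq_norm// andbT.
apply: lq_norm_le => // [r qr n|k]; last by have [->|/H->] := eqVneq k i.
have r0 : r != 0 by rewrite gt_eqF// -lte_fin -qr.
have [iN|Ni] := ltnP i n.
  rewrite (bigD1 (Ordinal iN))//= big1 ?addr0// => k ki.
  by rewrite H// powR0.
rewrite big1 ?powR_ge0// => k _; rewrite H ?powR0//.
by rewrite ltn_eqF// (leq_trans (ltn_ord k) Ni).
Qed.

Lemma lq_norm_upper q N (I : {set 'I_N}) (u : 'I_N -> nat -> R) v (b : R) :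
  (0 < q)%E -> 0 <= b -> (forall k m, 0 <= u k m) -> (forall m, 0 <= v m) ->
  in_lq q v ->
  (forall k, k \in I -> in_lq q (u k) /\ lq_norm q (u k) <= b) ->
  (forall m, v m = 0 \/ exists2 k, k \in I & v m <= u k m) ->
  lq_norm q v <= b * npow q N.
Proof.
move=> q0 b0 u0 v0 cv Hu Hv.
have B0 : 0 <= b * npow q N by rewrite mulr_ge0 ?npow_ge0.
have [N0|Npos] := posnP N.
  have Hv0 m : v m = 0 by case: (Hv m) => // -[k _ _]; case: k => k; rewrite N0.
  apply: lq_norm_le => // [r qr n|m]; last by rewrite Hv0.
  have r0 : r != 0 by rewrite gt_eqF// -lte_fin -qr.
  by rewrite big1 ?powR_ge0// => k _; rewrite Hv0 powR0.
have vb m : v m <= b.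
  case: (Hv m) => [->//|[k kI vu]]; apply: le_trans vu _.
  by have [ck nk] := Hu k kI; apply: le_trans (le_lq_norm m q0 (u0 k) ck) nk.
case: q q0 cv Hu B0 => [r| |//] q0 cv Hu B0; last first.
  by apply: lq_norm_le => // k; rewrite /npow /= powRr0 mulr1.
have r0 : 0 < r by rewrite -lte_fin.
apply: (lq_of_bound r0 B0 _).2 => n.
apply: (@le_trans _ _ (\sum_(k in I) series (fun m => u k m `^ r) n)).
  rewrite /series /= exchange_big /=; apply: ler_sum => m _.
  have S0 (P : pred 'I_N) : 0 <= \sum_(k | P k) u k m `^ r.
    by apply: sumr_ge0 => k _; exact: powR_ge0.
  case: (Hv m) => [->|[k kI vu]]; first by rewrite powR0// gt_eqF.
  rewrite (bigD1 k)//=; apply: (@le_trans _ _ (u k m `^ r)); last by rewrite lerDl.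
  by apply: ge0_ler_powR; rewrite ?nnegrE ?(ltW r0).
apply: (@le_trans _ _ (\sum_(k in I) b `^ r)).
  apply: ler_sum => k kI; have [ck nk] := Hu k kI.
  apply: le_trans (series_le_lq_norm n r0 ck) _.
  by apply: ge0_ler_powR; rewrite ?nnegrE ?(ltW r0)// (lq_norm_ge0 q0 (u0 k)).
rewrite sumr_const powRM ?npow_ge0// /npow /= powRVK// -[leLHS]mulr_natr.
by rewrite ler_wpM2l ?powR_ge0// ler_nat -[leqRHS]card_ord max_card.
Qed.

Lemma lq_norm_lower q N (I : {set 'I_N}) u (b : 'I_N -> nat -> bool) (c : R) :
  (0 < q)%E -> 0 <= c -> (0 < #|I|)%N -> (forall m, 0 <= u m) -> in_lq q u ->
  (forall k l m, b k m -> b l m -> k = l) ->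
  (forall k, k \in I -> c <= lq_norm q (fun m => if b k m then u m else 0)) ->
  c * npow q #|I| <= lq_norm q u.
Proof.
move=> q0 c0 I0 u0 cu disj Hc.
pose w k m := if b k m then u m else 0.
have w0 k m : 0 <= w k m by rewrite /w; case: ifP.
have wu k m : w k m <= u m by rewrite /w; case: ifP.
have cw k : in_lq q (w k) by case: (lq_mono q0 (w0 k) (wu k) cu).
have nw k : lq_norm q (w k) <= lq_norm q u by case: (lq_mono q0 (w0 k) (wu k) cu).
have nu0 := lq_norm_ge0 q0 u0 cu.
case: q q0 cu Hc cw nw nu0 => [r| |//] q0 cu Hc cw nw nu0; last first.
  have [k kI] := card_gt0P I0; rewrite /npow /= powRr0 mulr1.
  by apply: le_trans (Hc k kI) (nw k).
have r0 : 0 < r by rewrite -lte_fin.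
apply: (ler_powR_inv r0) => //; first by rewrite mulr_ge0 ?npow_ge0.
rewrite powRM ?npow_ge0// /npow /= powRVK// mulr_natr -sumr_const.
pose S k := series (fun m => w k m `^ r).
have lim_ge0 k : 0 <= limn (S k).
  apply: limr_ge; first exact: cw.
  by apply: nearW => n; apply: sumr_ge0 => m _; exact: powR_ge0.
apply: (@le_trans _ _ (\sum_(k in I) limn (S k))).
  apply: ler_sum => k kI; rewrite -[leRHS](powRVK r0)//.
  have H : c <= limn (S k) `^ r^-1 by exact: (Hc k kI).
  by apply: ge0_ler_powR; rewrite ?nnegrE ?(ltW r0) ?powR_ge0.
have cvS : (fun n => \sum_(k in I) S k n) @ \oo --> \sum_(k in I) limn (S k).
  by apply: cvg_big => [|k _]; [exact: add_continuous|exact: cw].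
rewrite -(cvg_lim _ cvS)//; apply: limr_le; first by apply/cvg_ex; eexists; exact: cvS.
apply: nearW => n; rewrite powRVK//; last first.
  by apply: limr_ge => //; apply: nearW => m; apply: sumr_ge0 => k _; exact: powR_ge0.
apply: le_trans (nondecreasing_cvgn_le (series_powR_nd r u) cu n).
rewrite /S /series /= exchange_big /=; apply: ler_sum => m _.
have [/existsP[k /andP[kI bk]]|nb] := boolP [exists k, (k \in I) && b k m].
  rewrite (bigD1 k)//= big1 ?addr0; first by rewrite /w bk.
  move=> l /andP[_ lk]; rewrite /w; case: ifP => [bl|_]; last by rewrite powR0// gt_eqF.
  by move: lk; rewrite (disj _ _ _ bl bk) eqxx.
rewrite big1 ?powR_ge0// => k kI; rewrite /w; case: ifP => [bk|_].
  by case/negP: nb; apply/existsP; exists k; rewrite kI.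
by rewrite powR0// gt_eqF.
Qed.

End lq_blocks.

(** * Entrywise maps, single entries and disjoint blocks in l_t(Y) *)

Section ell_maps.
Context {R : realType} {s : scalar_kind}.
Local Notation K := (scalar R s).
Variables (t : \bar R) (t0 : (0 < t)%E) (Y : quasiBanach R s).
Local Notation E := (ell_type t0 Y).
Local Notation norm := (@qnorm R s (ell t0 Y)).

Lemma ell_val_sum (I : Type) (r : seq I) (P : pred I) (F : I -> E) i :
  ell_val (\sum_(k <- r | P k) F k) i = \sum_(k <- r | P k) ell_val (F k) i.
Proof. by elim/big_rec2: _ => // k y1 y2 _ <-. Qed.

Lemma ell_val_linear (a : K) (f g : ell t0 Y) i :
  @ell_val R s t t0 Y (a *: f + g) i =
  a *: @ell_val R s t t0 Y f i + @ell_val R s t t0 Y g i.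
Proof. by []. Qed.

Lemma ell_map_subproof (h : nat -> Y -> Y)
    (hle : forall i y, qnorm (h i y) <= qnorm y) (f : E) :
  (fun i => h i (ell_val f i)) \in ell_pred t0.
Proof.
apply/ell_predP.
apply: (lq_mono t0 _ _ (ell_in f)).1 => i; [exact: qnorm_ge0|exact: hle].
Qed.

Definition ell_map h hle f : E := EllType (@ell_map_subproof h hle f).

Lemma ell_map_le h hle f : norm (@ell_map h hle f) <= norm f.
Proof.
apply: (lq_mono t0 _ _ (ell_in f)).2 => i; [exact: qnorm_ge0|exact: hle].
Qed.

Lemma ell_single_subproof (i : nat) (y : Y) :
  (fun k => if k == i then y else 0) \in ell_pred t0.
Proof.
apply/ell_predP; move: t0; case: t => [r| |//] r0.
  rewrite lte_fin in r0.
  apply: (lq_of_bound r0 (qnorm_ge0 y) _).1 => n; rewrite /series /= big_mkord.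
  have [iN|Ni] := ltnP i n.
    rewrite (bigD1 (Ordinal iN))//= eqxx big1 ?addr0// => k ki.
    have kiF : (k == i :> nat) = false by apply/negbTE; exact: ki.
    by rewrite kiF qnorm0 powR0// gt_eqF.
  rewrite big1 ?powR_ge0// => k _.
  by rewrite ltn_eqF ?qnorm0 ?powR0 ?gt_eqF// (leq_trans (ltn_ord k) Ni).
apply/cvgrPdist_le => e e0; exists i.+1 => // k /= ik.
by rewrite gtn_eqF// qnorm0 subrr normr0 ltW.
Qed.

Definition ell_single i y : E := EllType (ell_single_subproof i y).

Lemma qnorm_supp1 (f : E) i : (forall k, k != i -> ell_val f k = 0) ->
  norm f = qnorm (ell_val f i).
Proof.
move=> H; apply: (@lq_supp1 _ t (fun k => qnorm (ell_val f k)) i t0) => [k||k /H ->].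
- exact: qnorm_ge0.
- exact: ell_in.
- exact: qnorm0.
Qed.

Lemma qnorm_single i y : norm (ell_single i y) = qnorm y.
Proof. by rewrite (@qnorm_supp1 _ i) /= ?eqxx// => k /negbTE ->. Qed.

(** The truncation [g] is given by its values, so that masks of the double sequence can take its
    place. *)
Lemma ell_tail (f : E) (e : R) : 0 < e -> exists M,
  forall g : E, (forall i, ell_val g i = if (M <= i)%N then ell_val f i else 0) ->
  norm g <= e.
Proof.
move=> e0; have [M HM] := lq_tail t0 (fun k => qnorm_ge0 (ell_val f k)) (ell_in f) e0.
exists M => g Hg; apply: le_trans HM; rewrite le_eqVlt; apply/orP; left; apply/eqP.
rewrite /= /ell_norm; congr lq_norm; apply/funext => k; rewrite Hg.
by case: ifP; rewrite ?qnorm0.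
Qed.

Section disjoint_blocks.
Variables (N : nat) (I : {set 'I_N}) (b : 'I_N -> nat -> bool).
Hypothesis disj : forall k l m, b k m -> b l m -> k = l.

Lemma ell_sum_le (g : 'I_N -> E) (B : R) : 0 <= B ->
  (forall k, k \in I -> norm (g k) <= B) ->
  (forall k i, k \in I -> ~~ b k i -> ell_val (g k) i = 0) ->
  norm (\sum_(k in I) g k) <= B * npow t N.
Proof.
move=> B0 HB Hg.
apply: (@lq_norm_upper _ t N I (fun k m => qnorm (ell_val (g k) m))) => //.
- by move=> k m; exact: qnorm_ge0.
- by move=> m; exact: qnorm_ge0.
- exact: ell_in.
- by move=> k kI; split; [exact: ell_in|exact: HB].
move=> m; rewrite ell_val_sum.
have [/existsP[k /andP[kI bk]]|nb] := boolP [exists k, (k \in I) && b k m].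
  right; exists k => //; rewrite (bigD1 k)//= big1 ?addr0// => l /andP[lI lk].
  apply: Hg => //; apply/negP => bl; by rewrite (disj bl bk) eqxx in lk.
left; rewrite big1 ?qnorm0// => k kI; apply: Hg => //.
by apply/negP => bk; case/negP: nb; apply/existsP; exists k; rewrite kI.
Qed.

Lemma ell_norm_blocks_ge (f : E) (g : 'I_N -> E) (c : R) : 0 <= c -> (0 < #|I|)%N ->
  (forall k, k \in I -> c <= norm (g k)) ->
  (forall k i, k \in I -> qnorm (ell_val (g k) i) =
     if b k i then qnorm (ell_val f i) else 0) ->
  c * npow t #|I| <= norm f.
Proof.
move=> c0 I0 Hc Hg.
apply: (@lq_norm_lower _ t N I (fun m => qnorm (ell_val f m)) b) => //.
- by move=> m; exact: qnorm_ge0.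
- exact: ell_in.
move=> k kI; apply: le_trans (Hc k kI) _.
rewrite /= /ell_norm le_eqVlt; apply/orP; left; apply/eqP.
by congr lq_norm; apply/funext => m; exact: Hg.
Qed.

End disjoint_blocks.
End ell_maps.

Lemma monotone_blocks_disjoint (J : nat -> nat) (k l m : nat) :
  {homo J : i j / (i <= j)%N} ->
  (J k <= m < J k.+1)%N -> (J l <= m < J l.+1)%N -> k = l.
Proof.
move=> Jh /andP[k1 k2] /andP[l1 l2]; apply/eqP; case: ltngtP => // /Jh H.
  by have := leq_ltn_trans (leq_trans H l1) k2; rewrite ltnn.
by have := leq_ltn_trans (leq_trans H k1) l2; rewrite ltnn.
Qed.

(** * The space l_q(l_p) as an instance of mixed coordinates *)

Section mixed_ell.
Context {R : realType} {s : scalar_kind} (p q : \bar R).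
Hypotheses (hp : (0 < p)%E) (hq : (0 < q)%E).
Local Notation K := (scalar R s).
Local Notation S := (scalar_space R s).
Local Notation Y := (ell hp S).
Local Notation X := (ell hq Y).

Definition entry (f : X) (i j : nat) : K :=
  @ell_val R s p hp S (@ell_val R s q hq Y f i) j.

Lemma mask_le (b : nat -> bool) (i : nat) (y : S) :
  qnorm (if b i then y else 0) <= qnorm y.
Proof. by case: (b i) => //; rewrite qnorm0 qnorm_ge0. Qed.

Definition row_mask (b : nat -> bool) (y : Y) : Y := ell_map (mask_le b) y.

Lemma row_mask_le (B : nat -> nat -> bool) (i : nat) (y : Y) :
  qnorm (row_mask (B i) y) <= qnorm y.
Proof. exact: ell_map_le. Qed.

Definition mask (B : nat -> nat -> bool) (f : X) : X := ell_map (row_mask_le B) f.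

Lemma entryP f g : (forall i j, entry f i j = entry g i j) -> f = g.
Proof.
move=> H; apply: val_inj; apply/funext => i; apply: val_inj; apply/funext => j.
exact: H.
Qed.

Lemma entry_mask B f i j : entry (mask B f) i j = if B i j then entry f i j else 0.
Proof. by []. Qed.

Lemma entry_linear i j (a : K) (f g : X) :
  entry (a *: f + g) i j = a * entry f i j + entry g i j.
Proof.
rewrite /entry ell_val_linear.
exact: (@ell_val_linear R s p hp S a (@ell_val R s q hq Y f i)
  (@ell_val R s q hq Y g i) j).
Qed.

Definition entry_at i j (f : X) : K^o := entry f i j.

HB.instance Definition _ i j :=
  GRing.isLinear.Build K X K^o *:%R (entry_at i j) (entry_linear i j).

Lemma mask_linear B : linear (mask B).
Proof.
move=> a f g; apply: entryP => i j; rewrite entry_linear !entry_mask entry_linear.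
by case: (B i j) => //; rewrite mulr0 addr0.
Qed.

HB.instance Definition _ B :=
  GRing.isLinear.Build K X X *:%R (mask B) (@mask_linear B).

Definition unit_at i j : X :=
  @ell_single R s q hq Y i (@ell_single R s p hp S j (1 : K)).

Lemma entry_unit i j i' j' :
  entry (unit_at i' j') i j = ((i == i') && (j == j'))%:R.
Proof.
by rewrite /entry /=; case: (i == i') => //=; case: (j == j').
Qed.

Lemma entry_le i j (f : X) : modulus (entry f i j) <= qnorm f.
Proof.
apply: (@le_trans _ _ (qnorm (@ell_val R s q hq Y f i))).
  exact: (@qnorm_le_ell R s p hp S (@ell_val R s q hq Y f i) j).
exact: (@qnorm_le_ell R s q hq Y f i).
Qed.

Lemma unit_le1 i j : qnorm (unit_at i j) <= 1.
Proof. by rewrite /unit_at !qnorm_single /= modulus1. Qed.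

Lemma mask_le_norm B (f : X) : qnorm (mask B f) <= qnorm f.
Proof. exact: ell_map_le. Qed.

Lemma row_of_mask B (f : X) i :
  ell_val (mask B f) i = row_mask (B i) (ell_val f i).
Proof. by []. Qed.

Lemma row_mask_true (b : nat -> bool) (y : Y) : (forall j, b j) -> row_mask b y = y.
Proof. by move=> H; apply: val_inj; apply/funext => j /=; rewrite H. Qed.

Lemma row_mask_false (b : nat -> bool) (y : Y) : (forall j, ~~ b j) -> row_mask b y = 0.
Proof.
by move=> H; apply: val_inj; apply/funext => j /=; rewrite (negbTE (H j)).
Qed.

Lemma mask_rows_tail (f : X) (e : R) : 0 < e -> exists M,
  qnorm (mask (fun i _ => M <= i)%N f) <= e.
Proof.
move=> e0; have [M HM] := ell_tail f e0; exists M; apply: HM => i.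
rewrite row_of_mask; case: ifP => Mi; first by rewrite row_mask_true.
by rewrite row_mask_false.
Qed.

Lemma mask_row_tail i0 (f : X) (e : R) : 0 < e -> exists J,
  qnorm (mask (fun i j => (i == i0) && (J <= j)%N) f) <= e.
Proof.
move=> e0; have [J HJ] := ell_tail (ell_val f i0) e0; exists J.
rewrite (@qnorm_supp1 _ _ _ _ _ _ i0) => [|i ii0]; last first.
  by rewrite row_of_mask row_mask_false// => j; rewrite (negbTE ii0).
by apply: HJ => j; rewrite row_of_mask /= eqxx.
Qed.

Lemma mask_blocks_of_rows M : {homo M : m n / (m <= n)%N} ->
  spans_ell (fun B => mask B : {linear X -> X}) q (blocks_of_rows M).
Proof.
move=> Mh; pose b N (k : 'I_N) i := (M k <= i < M k.+1)%N.
have disj N k l m : @b N k m -> @b N l m -> k = l.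
  by move=> H1 H2; apply: ord_inj; exact: monotone_blocks_disjoint Mh H1 H2.
split=> [N I g B B0 H|N I h c c0 I0 H].
  apply: (@ell_sum_le _ _ _ hq Y N I (b N) (disj N) g B B0) => [k /H[]//|k i kI bk].
  have [<- _] := H k kI; rewrite row_of_mask row_mask_false//.
apply: (@ell_norm_blocks_ge _ _ _ hq Y N I (b N) (disj N) h
  (fun k => mask (blocks_of_rows M k) h) c c0 I0 H) => k i kI.
rewrite row_of_mask; case: ifP => bk; first by rewrite row_mask_true.
rewrite row_mask_false ?qnorm0// => j; rewrite /blocks_of_rows.
by apply/negbT; exact: bk.
Qed.

(** A vector living in row [i0] has the norm of that row, so both estimates reduce to disjoint
    blocks in l_p. *)
Lemma mask_row_blocks i0 J : {homo J : m n / (m <= n)%N} ->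
  spans_ell (fun B => mask B : {linear X -> X}) p (row_blocks i0 J).
Proof.
move=> Jh; pose b N (k : 'I_N) j := (J k <= j < J k.+1)%N.
have disj N k l m : @b N k m -> @b N l m -> k = l.
  by move=> H1 H2; apply: ord_inj; exact: monotone_blocks_disjoint Jh H1 H2.
have off_row k (f : X) i : i != i0 -> ell_val (mask (row_blocks i0 J k) f) i = 0.
  move=> ii0; rewrite row_of_mask row_mask_false// => j.
  by rewrite /row_blocks (negbTE ii0).
split=> [N I g B B0 H|N I h c c0 I0 H].
  rewrite (@qnorm_supp1 _ _ _ _ _ _ i0) => [|i ii0]; last first.
    rewrite ell_val_sum big1// => k kI; have [<- _] := H k kI; exact: off_row.
  rewrite ell_val_sum.
  apply: (@ell_sum_le _ _ _ hp S N I (b N) (disj N) (fun k => ell_val (g k) i0) B B0).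
    by move=> k /H[_]; apply: le_trans; exact: qnorm_le_ell.
  move=> k j kI bk; have [<- _] := H k kI.
  by rewrite row_of_mask /= /row_blocks eqxx /=; rewrite /b in bk; rewrite (negbTE bk).
apply: (@le_trans _ _ (qnorm (ell_val h i0 : Y))); last exact: qnorm_le_ell.
apply: (@ell_norm_blocks_ge _ _ _ hp S N I (b N) (disj N) (ell_val h i0)
  (fun k => ell_val (mask (row_blocks i0 J k) h) i0) c c0 I0).
  move=> k kI; have := H k kI.
  rewrite (@qnorm_supp1 _ _ _ _ _ _ i0)// => i; exact: off_row.
move=> k j kI; rewrite row_of_mask /= /row_blocks eqxx /= /b.
by case: ifP => // _; exact: modulus0.
Qed.

Definition ell_coordinates : mixed_coordinates p q X :=
  @MixedCoordinates R s p q X (fun i j => entry_at i j : {linear X -> K^o})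
    (fun B => mask B : {linear X -> X}) unit_at entryP
    (fun i j B f => entry_mask B f i j) entry_unit entry_le unit_le1 mask_le_norm
    mask_rows_tail mask_row_tail mask_row_blocks mask_blocks_of_rows.

End mixed_ell.

(** * Conclusion for l_q(l_p) *)

Local Open Scope ereal_scope.

Theorem proposition10p14 (R : realType) (s : scalar_kind) (p q : \bar R)
  (hp : 0 < p) (hq : 0 < q) (hpq : p != q) :
  ~ exists x : nat -> ell hq (ell hp (scalar_space R s)), greedy_basis x.
Proof.
move=> [x [xs [[dense [cont bio]] Mb sn [C C1 greedy]]]].
apply/negP: hpq; rewrite negbK; apply/eqP.
have bounded := coef_bound Mb sn; have [D1 D10 HD1] := bounded.
have [a [b [a0 Hab]]] := semi_normalized_bounds sn.
have [D2 D20 HD2] := partial_sum_bound bio C1 greedy bounded.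
have [D3 D30 HD3] := multiplier_bound bio C1 greedy bounded.
have [D4 D40 HD4] := democracy bio C1 greedy bounded.
have b0 : (0 <= b)%R.
  by have /andP[H1 H2] := Hab 0%N; exact: le_trans (ltW a0) (le_trans H1 H2).
(* The sum of all constants serves as the common bound [D]. *)
have D0 : (0 < D1 + b + D2 + D3 + D4)%R by lra.
apply: (greedy_exponents (ell_coordinates hp hq) D0) => //.
- move=> n f; apply: le_trans (HD1 n f) _; rewrite ler_wpM2r ?qnorm_ge0//; lra.
- move=> n; have /andP[_ H] := Hab n; apply: le_trans H _; lra.
- move=> f r e ur; apply: le_trans (HD3 f r e ur) _; rewrite ler_wpM2r ?qnorm_ge0//; lra.
- move=> f r ur; apply: le_trans (HD2 f r ur) _; rewrite ler_wpM2r ?qnorm_ge0//; lra.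
- move=> f r r' e ur ur' sr Hr; apply: le_trans (HD4 f r r' e ur ur' sr Hr) _.
  by rewrite ler_wpM2r ?qnorm_ge0//; lra.
- exact: (partial_sum_cvg bio C1 greedy bounded dense).
- exact: (coef_cvg0 bio bounded dense).
Qed.
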